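(* Let $\theta$ be a hook partition of $N$ and let $\mu/\nu$ be a skew shape with $|\mu/\nu|=N$ such that $\mu/\nu$ either (i) is pre-abelian, or (ii) contains no $3\times 3$ box. Then $\Gamma^\theta_{\mu/\nu}$ is the character of a permutation representation of $S_n$ whose transitive components are each isomorphic to the action of $S_n$ on cosets of a Young subgroup.
   Context: Partitions are weakly decreasing sequences of positive integers, extended by zeros when needed ($\nu$ may be empty). A skew shape $\mu/\nu$ is a pair of partitions with $\nu_i\le\mu_i$ for all $i$; its Young diagram is the diagram of $\mu$ with the boxes of $\nu$ removed; its length $\ell(\mu/\nu)$ is the largest $i$ with $\nu_i<\mu_i$, and $|\mu/\nu|=\sum_i(\mu_i-\nu_i)$. A hook partition of $N$ is $(N-k,1,\ldots,1)$ with $k$ ones after the first part, $0\le k\le N-1$. For $\theta\vdash N$ and an integer sequence $c=(c_1,\ldots,c_n)$ summing to $N$, the Kostka number $K_{\theta,c}$ is the number of semistandard Young tableaux of shape $\theta$ with content $c$; it is $0$ if some $c_i<0$. Fix $n\ge\ell(\mu/\nu)$ and let $\delta=(n-1,\ldots,1,0)$. Regard $\mu,\nu$ as their first $n$ entries, and let $w\in S_n$ act by $w(a_1,\ldots,a_n)=(a_{w^{-1}(1)},\ldots,a_{w^{-1}(n)})$. The immanant character $\Gamma^\theta_{\mu/\nu}:S_n\to\mathbb{Z}$ is $$\Gamma^\theta_{\mu/\nu}(w)=\frac{n!}{|C(w)|}\sum_{w'\in C(w)}K_{\theta,\ \mu+\delta-w'(\nu+\delta)},$$ where $C(w)$ is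 the conjugacy class of $w$. A Hessenberg function is a weakly increasing $h:[m]\to[m]$ with $h(i)\ge i$ for all $i$. It is abelian if $h(1)=m$ or $h(h(1)+1)=m$. Let $m=\ell(\mu/\nu)$. The Jacobi-Trudi matrix is the $m\times m$ matrix $H_{\mu/\nu}=[h_{\mu_i-\nu_j+j-i}]$ of complete homogeneous symmetric functions, with $h_0=1$ and $h_r=0$ for $r<0$. Let $H'_{\mu/\nu}$ be obtained from $H_{\mu/\nu}$ by replacing all entries $1$ by $0$; its pattern of nonzero entries determines $h'$, where $h'(j)$ is the row index of the last nonzero entry in column $j$, i.e. $h'(j)=\max\{i\in[m]:\mu_i-\nu_j+j-i>0\}$. The shape $\mu/\nu$ is pre-abelian if $h'$ is an abelian Hessenberg function (in particular $h'$ is a Hessenberg function). The shape contains a $3\times3$ box if its Young diagram contains all nine boxes in some three consecutive rows and three consecutive columns. A Young subgroup of $S_n$ is the subgroup preserving each block of a set partition of $[n]$. *)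

(* Defs.v *)
From HB Require Import structures.
From mathcomp Require Import all_boot all_order all_fingroup all_algebra.
From mathcomp Require Import all_solvable all_field all_character.

Set Implicit Arguments.
Unset Strict Implicit.
Unset Printing Implicit Defensive.

Import GRing.Theory.
Local Open Scope nat_scope.

Definition is_partition (la : seq nat) : bool :=
  sorted geq la && (0 \notin la).

(* The i-th part, counted from i = 1, with trailing zeros; the index i = 0 is
   never meaningful (it returns the first part). *)
Definition part (la : seq nat) (i : nat) : nat := nth 0 la i.-1.

Definition is_hook (N : nat) (theta : seq nat) : Prop :=
  exists2 k, k < N & theta = (N - k) :: nseq k 1.

Definition is_skew_shape (mu nu : seq nat) : Prop :=
  [/\ is_partition mu, is_partition nu
    & forall i, 0 < i -> part nu i <= part mu i].

(* A row i with nu_i < mu_i satisfies i <= size mu, whence the ranges below. *)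
Definition skew_length (mu nu : seq nat) : nat :=
  \max_(1 <= i < (size mu).+1 | part nu i < part mu i) i.

Definition skew_size (mu nu : seq nat) : nat :=
  \sum_(1 <= i < (size mu).+1) (part mu i - part nu i).

(* Rows and columns of diagrams are numbered from 1. *)
Definition in_skew_diagram (mu nu : seq nat) (i j : nat) : bool :=
  (0 < i) && (part nu i < j <= part mu i).

Definition contains_3x3_box (mu nu : seq nat) : Prop :=
  exists r c, forall a b, a < 3 -> b < 3 -> in_skew_diagram mu nu (r + a) (c + b).

(* Functions [m] -> [m] are given by their values at 1, ..., m. *)
Definition is_hessenberg (m : nat) (h : nat -> nat) : Prop :=
  (forall i, 1 <= i <= m -> i <= h i <= m) /\
  (forall i j, 1 <= i -> i <= j -> j <= m -> h i <= h j).

Definition is_abelian_hessenberg (m : nat) (h : nat -> nat) : Prop :=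
  is_hessenberg m h /\ (h 1 = m \/ h (h 1).+1 = m).

(* Row index of the last nonzero entry in column j of the Jacobi-Trudi matrix
   with its entries h_0 = 1 replaced by 0.  The value is 0 if that column is
   zero, in which case jt_hess mu nu is not a Hessenberg function. *)
Definition jt_hess (mu nu : seq nat) (j : nat) : nat :=
  \max_(1 <= i < (skew_length mu nu).+1 |
        (0 < (part mu i)%:Z - (part nu j)%:Z + j%:Z - i%:Z)%R) i.

Definition pre_abelian (mu nu : seq nat) : Prop :=
  is_abelian_hessenberg (skew_length mu nu) (jt_hess mu nu).

(* Boxes are numbered from 0 here, as are the letters 'I_n. *)
Notation box theta :=
  {b : 'I_(size theta) * 'I_(head 0 theta) | b.2 < nth 0 theta b.1}.

Definition box_row (theta : seq nat) (b : box theta) : nat := (val b).1.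
Definition box_col (theta : seq nat) (b : box theta) : nat := (val b).2.

Definition semistandard (n : nat) (theta : seq nat)
    (t : {ffun box theta -> 'I_n}) : bool :=
  [forall b, forall b',
     ((box_row b == box_row b') && (box_col b < box_col b') ==> (t b <= t b'))
     && ((box_col b == box_col b') && (box_row b < box_row b') ==>
         (t b < t b'))].

Definition has_content (n : nat) (theta : seq nat) (c : 'I_n -> int)
    (t : {ffun box theta -> 'I_n}) : bool :=
  [forall i, ((#|[set b | t b == i]|)%:Z)%R == c i].

(* No tableau has a content with a negative entry. *)
Definition kostka (n : nat) (theta : seq nat) (c : 'I_n -> int) : nat :=
  #|[set t : {ffun box theta -> 'I_n} | semistandard t && has_content c t]|.

(* The sequence la + delta with its first n entries, delta = (n-1, ..., 1, 0). *)
Definition shifted (n : nat) (la : seq nat) (i : 'I_n) : int :=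
  ((part la i.+1 + (n - i.+1))%N%:Z)%R.

Definition perm_seq (n : nat) (w : 'S_n) (a : 'I_n -> int) : 'I_n -> int :=
  fun i => a ((w^-1)%g i).

(* The quotient by the size of the conjugacy class is exact. *)
Definition immanant_char (n : nat) (theta mu nu : seq nat) (w : 'S_n) : int :=
  let C := (w ^: [set: 'S_n])%g in
  ((n`! %/ #|C|)%N%:Z *
     \sum_(w' in C)
        (kostka theta
           (fun i => shifted mu i - perm_seq w' (shifted nu) i))%:Z)%R.

Section PermutationRepresentation.

Variables (gT : finGroupType) (T : finType) (to : {action gT &-> T}).

Definition perm_repr_mx (g : gT) : 'M[algC]_#|T| :=
  \matrix_(i, j) ((to (enum_val i) g == enum_val j)%:R)%R.

Lemma perm_repr_mx_repr : mx_repr [set: gT] perm_repr_mx.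
Proof.
split=> [|g h _ _]; apply/matrixP=> i j.
  by rewrite !mxE act1 (inj_eq enum_val_inj).
rewrite !mxE (bigD1 (enum_rank (to (enum_val i) g))) //= !mxE enum_rankK eqxx.
rewrite mul1r -actM big1 ?addr0 // => k nk; rewrite !mxE.
case: eqP => [Ek|_]; last by rewrite mul0r.
by rewrite Ek enum_valK eqxx in nk.
Qed.

Definition perm_repr : mx_representation algC [set: gT] #|T| :=
  MxRepresentation perm_repr_mx_repr.

End PermutationRepresentation.

Definition is_young_subgroup (n : nat) (H : {group 'S_n}) : Prop :=
  exists2 P : {set {set 'I_n}}, partition P [set: 'I_n]
    & H :=: [set s : 'S_n | [forall B in P, s @: B == B]].

(* Permutations compose from left to right in the library and its actions are
   right actions, so the cosets are right cosets under right translation;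
   g |-> g^-1 turns this into left actions on left cosets. *)
Definition orbit_isom_cosets (gT : finGroupType) (T : finType)
    (to : {action gT &-> T}) (x : T) (H : {group gT}) : Prop :=
  exists f : T -> {set gT},
    [/\ {in orbit to [set: gT] x &, injective f},
        f @: orbit to [set: gT] x = rcosets H [set: gT]
      & {in orbit to [set: gT] x, forall y g, f (to y g) = (f y :* g)%g}].

Definition is_young_permutation_character (n : nat) (chi : 'S_n -> int) : Prop :=
  exists (T : finType) (to : {action 'S_n &-> T}),
    (forall w : 'S_n, ((chi w)%:~R)%R = cfRepr (perm_repr to) w) /\
    (forall x : T, exists2 H : {group 'S_n},
        is_young_subgroup H & orbit_isom_cosets to x H).

(* Main.v *)
(** A tableau of hook shape (N-k, 1^k) with content c >= 0 is determined by the
    letters of its leg, so K = binomial(s-1, k) where s is the number of nonzero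
    entries of c.  For c = mu+delta - w(nu+delta) we have s - 1 = (n-1-r) + u,
    where r is the number of entries h_0 = 1 of the Jacobi-Trudi matrix and u
    the number of those that w does not use.  Vandermonde's identity turns the
    sum over w into a nonnegative combination of the sums X_H(F) of a class
    function F over the permutations w <= H, where H runs over the Hessenberg
    functions obtained from the Jacobi-Trudi pattern by removing some of these
    entries, which are corners of it.

    It remains to write X_H as a nonnegative integral combination of sums over
    Young subgroups.  This is the Stanley-Stembridge conjecture, and the weights
    are those of Hikita's theorem at q = 1: the vertices 1, ..., n successively
    choose columns c_1, ..., c_n, the next column being x with probability the
    residue at z = x of 1/z * prod (z-m)/(z-m-1), where m runs over the columns
    of the earlier neighbours (columns are numbered from 0).  Both X_H and the
    resulting sum over words c satisfy the modular law, i.e. are affine when one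
    vertex moves across two vertices that are otherwise twins: X_H by conjugating
    with the transposition of the twins, the sum over words by a rational
    identity for c and its composition with that transposition.  They agree on
    disjoint unions of cliques, and the modular law determines a function on
    Hessenberg functions from these values.  Finally the coefficients are
    integral because pairing with the characters induced from the sign
    characters of Young subgroups is triangular. *)

Require Import Defs.
From mathcomp Require Import all_boot all_order all_fingroup all_algebra.
From mathcomp Require Import all_solvable all_field all_character.
From mathcomp Require Import zify ring lra.

Set Implicit Arguments.
Unset Strict Implicit.
Unset Printing Implicit Defensive.

Import Order.TTheory GRing.Theory Num.Theory GroupScope.

(** * The modular law, and a ranking of Hessenberg functions *)

Section Uniqueness.

Local Open Scope nat_scope.

(** Vertices are numbered from 0, and [i] is joined to [i + 1, ..., H i - 1]: the value [H i] is the
    first vertex beyond the right neighbours of [i]. *)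
Definition hess (n : nat) (H : nat -> nat) : Prop :=
  (forall i, i < n -> i < H i <= n) /\
  (forall i j, i <= j -> j < n -> H i <= H j).

Definition upd (H : nat -> nat) (i x : nat) : nat -> nat :=
  fun k => if k == i then x else H k.

(** Every other vertex is joined to both [s] and [s + 1] or to neither: on the right because
    [H s = H s.+1], on the left because no neighbourhood ends between them. *)
Definition twin (n : nat) (H : nat -> nat) (s : nat) : Prop :=
  [/\ s.+1 < n, H s = H s.+1 & forall j, j < n -> H j != s.+1].

(** The three functions differ in the edges from the twins to their last common neighbour [v]: both,
    one, or none of them are present. *)
Definition row_law (n : nat) (f : (nat -> nat) -> rat) : Prop :=
  forall H s v, hess n H -> twin n H s -> s.+1 < v < n -> H s = v.+1 ->
  hess n (upd H s v) -> hess n (upd (upd H s v) s.+1 v) ->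
  (f H + f (upd (upd H s v) s.+1 v) = 2 * f (upd H s v))%R.

(** The mirror case: the vertex [i] lies to the left of the twins, which are its last two
    neighbours. *)
Definition col_law (n : nat) (f : (nat -> nat) -> rat) : Prop :=
  forall H i s, hess n H -> twin n H s -> i < s -> H i = s.+2 ->
  hess n (upd H i s.+1) -> hess n (upd H i s) ->
  (f H + f (upd H i s) = 2 * f (upd H i s.+1))%R.

(** The last vertex reached from [x] reaches no further, so the graph is a disjoint union of cliques
    on intervals. *)
Definition clique_union (n : nat) (H : nat -> nat) : Prop :=
  forall x, x < n -> H (H x).-1 = H x.

(** The number with base-[B] digits [d 0, ..., d (k-1)], the most significant first; it turns a
    lexicographic order into an order of naturals. *)
Definition encode (B : nat) (d : nat -> nat) (k : nat) : nat :=
  iteri k (fun j e => e * B + d j) 0.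

Lemma encode_lt B d d' s k :
    (forall j, d' j < B) -> (forall j, j < s -> d' j = d j) -> d' s < d s ->
  s < k -> encode B d' k < encode B d k.
Proof.
move=> dB eqd ltd.
have encS (e : nat -> nat) j : encode B e j.+1 = encode B e j * B + e j by [].
have eqs j : j <= s -> encode B d' j = encode B d j.
  by elim: j => // j IH js; rewrite !encS IH ?eqd // ltnW.
elim: k => // k IH; rewrite ltnS leq_eqVlt !encS => /orP[/eqP <-|/IH lt].
  by rewrite eqs // ltn_add2l.
by have := dB k; nia.
Qed.

Section Bounce.

Variable n : nat.

(** The bounce path 0, H 0, H (H 0), ..., constant once it reaches [n]. Its points cut the vertices
    into blocks. *)
Definition bounce (H : nat -> nat) (k : nat) : nat :=
  iter k (fun x => if x < n then H x else n) 0.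

Definition area (H : nat -> nat) : nat := \sum_(i < n) H i.

Definition rank_digit (H : nat -> nat) (k : nat) : nat :=
  if k < n then n - bounce H k else area H.

(* Orders Hessenberg functions by bounce path first, a larger bounce path being
   smaller, and then by area. *)
Definition hrank (H : nat -> nat) : nat :=
  encode (n * n).+1 (rank_digit H) n.+1.

Lemma bounce_le H k : hess n H -> bounce H k <= n.
Proof.
move=> [h1 _]; case: k => [|k] //=; case: ifP => // lt.
by have /andP[] := h1 _ lt.
Qed.

Lemma rank_digit_lt H k : hess n H -> rank_digit H k < (n * n).+1.
Proof.
move=> hH; rewrite /rank_digit; case: ifP => kn; first by nia.
rewrite ltnS /area -[X in _ <= X * _]card_ord -sum_nat_const.
by apply: leq_sum => i _; have /andP[] := hH.1 _ (ltn_ord i).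
Qed.

Lemma bounceS H k : bounce H k < n -> bounce H k.+1 = H (bounce H k).
Proof. by rewrite /= => ->. Qed.

Lemma bounce_ge H k : hess n H -> minn k n <= bounce H k.
Proof.
move=> hH; elim: k => [|k IH]; first by rewrite min0n.
rewrite /=; case: ifP => lt; last by rewrite geq_minr.
by have := hH.1 _ lt; lia.
Qed.

Lemma bounce_lt_ind H k : hess n H -> bounce H k < n -> k < n.
Proof. by move=> hH lt; have := bounce_ge k hH; lia. Qed.

Lemma bounce_mono H k l : hess n H -> k < l -> bounce H k < n ->
  bounce H k < bounce H l.
Proof.
move=> hH; elim: l => // l IH; rewrite ltnS leq_eqVlt => /orP[/eqP->|kl] kn.
  by rewrite bounceS //; have := hH.1 _ kn; lia.
have := IH kl kn => lt /=; case: ifP => // /[dup] ltn /hH.1; lia.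
Qed.

Lemma bounce_leq H k l : hess n H -> k <= l -> bounce H k <= bounce H l.
Proof.
move=> hH; rewrite leq_eqVlt => /orP[/eqP-> //|kl].
have [kn|kn] := ltnP (bounce H k) n; first by rewrite ltnW // bounce_mono.
elim: l kl => // l IH; rewrite ltnS leq_eqVlt /= => /orP[/eqP <-|/IH kl].
  by case: ifP => [lt|_]; [have := leq_trans lt kn; lia | exact: bounce_le].
by case: ifP => [lt|_]; [have := leq_trans lt kn; lia | exact: bounce_le].
Qed.

(** Raising [H] at the first bounce point where it changes enlarges the next bounce point. That this
    next point is below [n] keeps its digit ahead of the area digit. *)
Lemma hrank_bounce H H' k : hess n H -> hess n H' ->
    (forall j, j < k -> H' (bounce H j) = H (bounce H j)) ->
    bounce H k < n -> H (bounce H k) < n ->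
    H (bounce H k) < H' (bounce H k) ->
  hrank H' < hrank H.
Proof.
move=> hH hH' eqH kn Hkn lt.
have eqb j : j <= k -> bounce H' j = bounce H j.
  elim: j => // j IH jk; rewrite /= IH ?(ltnW jk) // eqH //.
have k1n : k.+1 < n by apply: (bounce_lt_ind hH); rewrite bounceS.
rewrite /hrank; apply: (@encode_lt _ _ _ k.+1 _ (fun j => @rank_digit_lt H' j hH')).
- by move=> j jk; rewrite /rank_digit (ltn_trans jk k1n) eqb.
- rewrite /rank_digit k1n !bounceS ?eqb //.
  by have := hH'.1 _ kn; lia.
- lia.
Qed.

Lemma hrank_area H H' : hess n H -> hess n H' ->
    (forall j, bounce H j < n -> H' (bounce H j) = H (bounce H j)) ->
    area H' < area H ->
  hrank H' < hrank H.
Proof.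
move=> hH hH' eqH lt.
have eqb j : bounce H' j = bounce H j.
  by elim: j => //= j ->; case: ifP => // /eqH.
rewrite /hrank; apply: (@encode_lt _ _ _ n _ (fun j => @rank_digit_lt H' j hH')) => //.
- by move=> j jn; rewrite /rank_digit jn eqb.
- by rewrite /rank_digit ltnn.
Qed.

Lemma area_upd H i x : i < n -> x < H i -> area (upd H i x) < area H.
Proof.
move=> lt xi; rewrite /area (bigD1 (Ordinal lt)) //= [X in _ < X](bigD1 (Ordinal lt)) //=.
rewrite /upd eqxx -addSn leq_add //; apply: leq_sum => j.
by rewrite -val_eqE /= => /negPf->.
Qed.

Lemma hess_upd H i x : hess n H -> i < n -> i < x ->
    x <= H i -> (0 < i -> H i.-1 <= x) -> hess n (upd H i x).
Proof.
move=> [h1 h2] lt ix xH Hx; split=> [j jn|j k jk kn]; rewrite /upd.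
  by case: eqP => [->|_]; [have := h1 _ lt; lia | apply: h1].
case: eqP => [ji|ji]; case: eqP => [ki|ki] //.
- by apply: leq_trans xH _; rewrite -ji h2.
- by apply: leq_trans (Hx _); [apply: h2; lia|lia].
- exact: h2.
Qed.

End Bounce.
End Uniqueness.

(** * Uniqueness of functions satisfying the modular law *)

Section Uniqueness2.
Local Open Scope nat_scope.
Variable n : nat.

Lemma bounce_block H x : hess n H -> x < n ->
  exists j, bounce n H j <= x < bounce n H j.+1.
Proof.
move=> hH xn; have ex : exists j, x < bounce n H j.
  by exists n; apply: leq_trans (bounce_ge n hH); rewrite minnn.
case: (ex_minnP ex) => -[|j] xj jmin; first by rewrite ltn0 in xj.
by exists j; rewrite xj andbT leqNgt; apply/negP => /jmin; rewrite ltnn.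
Qed.

(* Two consecutive blocks j, j+1 of the bounce path that are joined by an edge;
   e is the first vertex joined to block j+1, and the vertices of that block
   that e reaches have equal right neighbourhoods. *)
Definition good_block H j e :=
  let p := bounce n H j in
  [&& p < n, H p < n, p < e < H p, H e.-1 == H p, H p < H e
    & H (H e).-1 == H (H p)].

Lemma first_joined H p : hess n H -> p < n -> H p < H (H p).-1 ->
  exists e, [&& p < e < H p, H e.-1 == H p & H p < H e].
Proof.
move=> [h1 h2] pn ht.
case: (ex_minnP (ex_intro (fun y => H p < H y) _ ht)) => e he emin.
have pe : p < e.
  by rewrite ltnNge; apply/negP => /h2/(_ pn) hle; rewrite ltnNge hle in he.
have ep : e < H p by have := emin _ ht; have := h1 _ pn; lia.
exists e; rewrite pe ep he /= andbT eqn_leq.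
apply/andP; split; last by apply: h2; [lia | have := h1 _ pn; lia].
by rewrite leqNgt; apply/negP => /emin; lia.
Qed.

(** The last block that is joined to its successor is good: the successor is not joined to the block
    after it, so all its vertices reached from [e] stop at its end. *)
Lemma good_block_exists H : hess n H -> ~ clique_union n H ->
  exists j, exists e, good_block H j e.
Proof.
move=> hH ncl; have [h1 h2] := hH.
have [x hx] : exists x : 'I_n, H (H x).-1 != H x.
  apply/existsP; apply/contraT; rewrite negb_exists => /forallP hall.
  case: ncl => x xn; apply/eqP; have := hall (Ordinal xn).
  by rewrite negbK.
pose linked j := [&& bounce n H j < n & H (bounce n H j) < H (H (bounce n H j)).-1].
have ex : exists j, linked j.
  have [j /andP[jx xj]] := bounce_block hH (ltn_ord x).
  have jn : bounce n H j < n by apply: leq_ltn_trans jx _.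
  rewrite bounceS // in xj.
  exists j; rewrite /linked jn /=; have hj := h1 _ jn; have hx1 := h1 _ (ltn_ord x).
  have hjx := h2 _ _ jx (ltn_ord x).
  have hle : H (bounce n H j) <= H (H (bounce n H j)).-1 by apply: h2; lia.
  rewrite ltn_neqAle hle andbT; apply: contra hx => /eqP e.
  have hxe : H x = H (bounce n H j).
    by apply/eqP; rewrite eqn_leq hjx andbT e; apply: h2; lia.
  by rewrite hxe -e.
have bd j : linked j -> j <= n by case/andP => jn _; rewrite ltnW // (bounce_lt_ind hH).
case: (ex_maxnP ex bd) => j /andP[jn hj] jmax.
have [e /and3P[pep he1 he]] := first_joined hH jn hj.
exists j, e; rewrite /good_block jn pep he1 he /=.
have hpe : H e <= n by have /h1/andP[] : e < n; [have := h1 _ jn; lia|].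
have pn : H (bounce n H j) < n by lia.
rewrite pn /= eqn_leq; apply/andP; split; last by apply: h2; lia.
have [lt|ge] := ltnP (H (H (bounce n H j))) n; last first.
  by apply: leq_trans ge; have /h1/andP[] : (H e).-1 < n by lia.
have : ~~ linked j.+1 by apply/negP => /jmax; rewrite ltnn.
rewrite /linked bounceS // pn /= -leqNgt => hle; apply: leq_trans hle.
have le2 : H e <= H (H (bounce n H j)) by apply: h2; lia.
by apply: h2; have := h1 _ pn; lia.
Qed.

(** The first good block is taken. A vertex [x] violating the condition would join the preceding
    block to this one, the first such edge ending at most at [e]; as all vertices of the block
    before [e] have the value [H p], the preceding block would be good. *)
Lemma good_block_min H : hess n H -> ~ clique_union n H ->
  exists j, exists e, good_block H j e /\
    forall x, x < bounce n H j -> ~~ (bounce n H j < H x <= e).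
Proof.
move=> hH ncl; have [h1 h2] := hH.
pose goodj j := [exists e : 'I_n, good_block H j e].
have ex : exists j, goodj j.
  have [j [e ge]] := good_block_exists hH ncl; exists j; apply/existsP.
  have en : e < n.
    by case/and5P: ge => pn hpn /andP[_ ep] _ _; apply: ltn_trans ep hpn.
  by exists (Ordinal en).
case: (ex_minnP ex) => j /existsP[e ge] jmin; exists j, e; split=> // x xp.
apply/negP => /andP[pHx Hxe].
case: j => [//|j] in ge jmin xp pHx *.
suff : goodj j by move/jmin; rewrite ltnn.
have qn : bounce n H j < n.
  rewrite ltnNge; apply/negP => nq; case/and5P: ge => [+ _ _ _ _] /=.
  by rewrite /bounce iterS -/(bounce n H j) (leq_gtF nq) ltnn.
rewrite bounceS // in xp pHx; move: ge; rewrite /good_block bounceS //.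
set q := bounce n H j in qn xp pHx *.
case/and5P => pn hpn /andP[pe ep] /eqP he1 /andP[he /eqP hee].
have lk : H q < H (H q).-1 by apply: leq_trans pHx _; apply: h2; lia.
have [e' /and3P[qe' he'1 he']] := first_joined hH qn lk.
have e'n : e' < n by lia.
apply/existsP; exists (Ordinal e'n); rewrite /good_block -/q qn pn qe' he'1 he' /=.
have e'x : e' <= x.
  rewrite leqNgt; apply/negP => xe'; have : H x <= H e'.-1 by apply: h2; lia.
  by rewrite (eqP he'1); lia.
have he'e : H e' <= e by apply: leq_trans Hxe; apply: h2; lia.
rewrite eqn_leq; apply/andP; split; last by apply: h2; lia.
by rewrite -he1; apply: h2; lia.
Qed.

Lemma bounce_skip H j e k : hess n H -> bounce n H j < n ->
  bounce n H j < e < H (bounce n H j) -> bounce n H k != e.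
Proof.
move=> hH jn; rewrite -bounceS // => /andP[je ej]; apply/eqP => ke.
have [kj|jk] := leqP k j; first by have := bounce_leq hH kj; lia.
by have := bounce_leq hH jk; lia.
Qed.

(** Induction on [hrank]: at the first good block one of the laws, iterated in the second case,
    expresses [f H] by values at functions with a larger bounce path, or with the same one and
    smaller area. *)
Theorem hess_unique (f : (nat -> nat) -> rat) :
    (forall H H', (forall i, i < n -> H i = H' i) -> f H = f H') ->
    row_law n f -> col_law n f ->
    (forall H, hess n H -> clique_union n H -> f H = 0%R) ->
  forall H, hess n H -> f H = 0%R.
Proof.
move=> fext rlaw claw fcl H; have [r] := ubnP (hrank n H).
elim: r H => // r IH H; rewrite ltnS => Hr hH; have [h1 h2] := hH.
have [/forallP cl|/forallPn[x0 hx0]] :=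
    boolP [forall x : 'I_n, H (H x).-1 == H x].
  by apply: fcl => // x xn; apply/eqP; apply: (cl (Ordinal xn)).
have ncl : ~ clique_union n H by move=> /(_ x0 (ltn_ord x0)) /eqP; apply/negP.
have IHlt H' : hrank n H' < hrank n H -> hess n H' -> f H' = 0%R.
  by move=> lt; apply: IH; apply: leq_trans lt Hr.
have [j [e [/and5P[pn hpn /andP[pe ep] /eqP he1 /andP[he /eqP hee]] nox]]] :=
  good_block_min hH ncl.
set p := bounce n H j in pn hpn pe ep he1 he hee nox.
have en : e < n by lia.
have Hen : H e <= n by have /andP[] := h1 _ en.
have areaz x : H p <= x < H e -> hess n (upd H e x) /\ f (upd H e x) = 0%R.
  move=> /andP[px xe]; have hx : hess n (upd H e x) by apply: hess_upd => //; lia.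
  split=> //; apply: IHlt => //; apply: hrank_area => //; last exact: area_upd.
  move=> k _; rewrite /upd (negPf (bounce_skip k hH pn _)) //.
  by rewrite -/p pe.
(* If [e] reaches at least two vertices of the next block, the last two of them are twins. Lowering
   [H e] keeps the bounce path and decreases the area, so the column law applies. *)
have [big|small] := leqP (H p).+2 (H e).
  set s := (H e).-2; have sE : H e = s.+2 by rewrite /s; lia.
  have [hx0' f0] := areaz s.+1 ltac:(lia); have [hx1 f1] := areaz s ltac:(lia).
  have tw : twin n H s.
    split; first lia.
      have hs1 : H s <= H s.+1 by apply: h2; lia.
      have hs2 : H (H p) <= H s by apply: h2; lia.
      have hsE : (H e).-1 = s.+1 by lia.
      by rewrite hsE in hee; lia.
    move=> k kn; apply/eqP => hk; have [ke|ek] := ltnP k e.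
      by have le := h2 k e.-1 ltac:(lia) ltac:(lia); lia.
    by have := h2 _ _ ek kn; lia.
  by have := claw H e s hH tw ltac:(lia) sE hx0' hx1; rewrite f0 f1 mulr0 addr0.
have {small}HeE : H e = (H p).+1 by lia.
(* Here [e] reaches a single vertex of the next block, and [g x] joins exactly [x, ..., e] to it.
   Thus [g e] is [H], [g e.+1] has smaller area, and [g p] has a larger bounce path. *)
pose g x := fun y => if p <= y <= e then (if x <= y then (H p).+1 else H p) else H y.
have Hpe y : p <= y -> y < e -> H y = H p.
  move=> py ye; apply/eqP; rewrite eqn_leq -{1}he1.
  by rewrite (h2 y e.-1) ?(h2 p y); lia.
have gge x : p <= x <= e.+1 -> hess n (g x).
  move=> xpe; split=> [i iN|i k ik kn]; rewrite /g.
    have [/andP[pi ie]|_] := boolP (p <= i <= e); last exact: h1.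
    by case: ifP => _; lia.
  have [/andP[pi ie]|nie] := boolP (p <= i <= e);
    have [/andP[pk ke]|nke] := boolP (p <= k <= e).
  - by do 2![case: ifP]; lia.
  - have le := h2 e k ltac:(lia) ltac:(lia).
    by case: ifP; lia.
  - have le := h2 i p ltac:(lia) ltac:(lia).
    by case: ifP; lia.
  - exact: h2.
(* The vertices [x.-1] and [x] are twins for [g x.-1]; [nox] ensures that no neighbourhood of a
   vertex before the block ends between them. *)
have law x : p < x <= e -> (f (g x.-1) + f (g x.+1) = 2 * f (g x))%R.
  move=> /andP[px xe]; have hg := gge.
  have e0 y : upd (g x.-1) x.-1 (H p) y = g x y.
    rewrite /upd /g; case: eqP => [->|ne].
      by rewrite ifT; [rewrite ifF //; lia | lia].
    by case: (boolP (p <= y <= e)) => // _; have -> : (x.-1 <= y) = (x <= y) by lia.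
  have e1 y : upd (upd (g x.-1) x.-1 (H p)) x.-1.+1 (H p) y = g x.+1 y.
    rewrite {1}/upd; case: eqP => [->|ne].
      rewrite /g; case: ifP => [_|]; last by lia.
      by rewrite ifF; lia.
    rewrite e0 /g; case: (boolP (p <= y <= e)) => // _.
    by have -> : (x < y) = (x <= y) by lia.
  rewrite -(fext _ _ (fun y _ => e0 y)) -(fext _ _ (fun y _ => e1 y)).
  have hext F G : (forall y, F y = G y) -> hess n G -> hess n F.
    by move=> eFG [k1 k2]; split=> [i|i k]; rewrite !eFG; auto.
  apply: rlaw => //.
  - by apply: hg; lia.
  - split; first lia.
      by rewrite /g !ifT //; lia.
    move=> k kn; rewrite /g; case: ifP => [_|/negbT nk]; first by case: ifP; lia.
    have [kp|pk] := ltnP k p; first by have := nox k kp; lia.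
    by have le := h2 e k ltac:(lia) ltac:(lia); lia.
  - by lia.
  - by rewrite /g !ifT //; lia.
  - by apply: hext e0 _; apply: hg; lia.
  - by apply: hext e1 _; apply: hg; lia.
have gp : f (g p) = 0%R.
  apply: IHlt; last by apply: gge; lia.
  apply: (@hrank_bounce n H (g p) j) => //; rewrite -/p //.
  - by apply: gge; lia.
  - by move=> k kj; rewrite /g ifF //; have := bounce_mono hH kj; rewrite -/p; have := bounce_leq hH (ltnW kj); rewrite -/p; lia.
  - by rewrite /g leqnn (ltnW pe) /=.
have ge1 : f (g e.+1) = 0%R.
  have [_ <-] := areaz (H p) ltac:(lia); apply: fext => y _; rewrite /g /upd.
  case: eqP => [->|ne]; first by rewrite ifT ?ifF //; lia.
  case: ifP => // /andP[py ye]; rewrite Hpe //; last by lia.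
  by rewrite ifF //; lia.
(* The row law makes [f (g (p + k))] affine in [k]. It vanishes at both ends, hence everywhere, in
   particular at [g e]. *)
have lin k : k <= e.+1 - p -> (f (g (p + k)%N) = k%:R * f (g p.+1))%R.
  elim/ltn_ind: k => -[|[|k]] IHk kl; first by rewrite addn0 mul0r.
    by rewrite addn1 mul1r.
  have e1 : (p + k.+1).-1 = p + k by rewrite addnS.
  have e2 : (p + k.+1).+1 = p + k.+2 by rewrite !addnS.
  have := law (p + k.+1) ltac:(lia); rewrite e1 e2 (IHk k) ?(IHk k.+1) //; try lia.
  rewrite -(natr1 k.+1) -(natr1 k); move: (f _) (f _) (k%:R : rat)%R => u v x.
  by move=> h; lra.
have gp1 : f (g p.+1) = 0%R.
  have := lin (e.+1 - p) (leqnn _); rewrite subnKC; last lia.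
  rewrite ge1 => /esym/eqP; rewrite mulf_eq0 pnatr_eq0 => /orP[|/eqP //]; lia.
have := lin (e - p) ltac:(lia); rewrite subnKC; last lia.
rewrite gp1 mulr0 => <-; apply: fext => y _; rewrite /g.
case: ifP => // /andP[py ye]; case: ifP => h; first by have -> : y = e by lia.
by rewrite Hpe //; lia.
Qed.

End Uniqueness2.

(** * The modular law for sums over the permutations below a Hessenberg function *)

Section ClassSums.

Local Open Scope ring_scope.

Variable n : nat.
Implicit Types (H : nat -> nat) (w : 'S_n).

Definition class_function (F : 'S_n -> rat) : Prop :=
  forall w g : 'S_n, F (w ^ g)%g = F w.

Definition hess_perm H w : bool := [forall j : 'I_n, (w j < H j)%N].

Definition hess_sum H (F : 'S_n -> rat) : rat := \sum_(w | hess_perm H w) F w.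

Lemma hess_sum_ext F H H' :
  (forall i, (i < n)%N -> H i = H' i) -> hess_sum H F = hess_sum H' F.
Proof.
move=> eqH; apply: eq_bigl => w; apply: eq_forallb => j.
by rewrite eqH.
Qed.

Lemma hess_perm_upd H i x w : (x < H i)%N -> (i < n)%N ->
  hess_perm (upd H i x) w =
  hess_perm H w && [forall j : 'I_n, (j == i :> nat) ==> (w j < x)%N].
Proof.
move=> xH ltin; apply/forallP/andP => [hw|[/forallP hw /forallP hi] j].
  split; apply/forallP => j; have := hw j; rewrite /upd; case: eqP => //= ->.
  by move/ltn_trans; apply.
have := hi j; have := hw j; rewrite /upd; case: eqP => //=.
Qed.

Lemma conj_permE (w g : 'S_n) i : (w ^ g)%g (g i) = g (w i).
Proof. by rewrite permJ. Qed.

Lemma sum_conj (F : 'S_n -> rat) (g : 'S_n) (P Q : pred 'S_n) :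
    class_function F -> (forall w, P (w ^ g)%g = Q w) ->
  \sum_(w | P w) F w = \sum_(w | Q w) F w.
Proof.
move=> cF PQ; rewrite (reindex_inj (conjg_inj g)).
by apply: eq_big => [w|w _]; [exact: PQ | exact: cF].
Qed.

(** Conjugation by [g] preserves [P] and carries [R] to [Q], so the disjoint parts of the sum lying
    in [Q] and in [R] are equal. Removing them one after the other subtracts the same amount
    twice. *)
Lemma sum_two_step (F : 'S_n -> rat) (g : 'S_n) (P Q R : pred 'S_n) :
    class_function F -> (forall w, P (w ^ g)%g = P w) ->
    (forall w, Q (w ^ g)%g = R w) -> (forall w, R w -> ~~ Q w) ->
  \sum_(w | P w) F w + \sum_(w | [&& P w, ~~ Q w & ~~ R w]) F w
    = 2 * \sum_(w | P w && ~~ Q w) F w.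
Proof.
move=> cF PP QR excl; rewrite (bigID Q) /=.
rewrite [in RHS](bigID R) /=.
have -> : \sum_(w | P w && Q w) F w = \sum_(w | P w && R w) F w.
  by apply: (sum_conj (g := g)) => // w; rewrite PP QR.
have -> : \sum_(w | P w && ~~ Q w) F w =
    \sum_(w | P w && R w) F w + \sum_(w | [&& P w, ~~ Q w & ~~ R w]) F w.
  rewrite (bigID R) /=; congr (_ + _); apply: eq_bigl => w; last by rewrite andbA.
  by rewrite -andbA; case: (boolP (R w)) => [/excl ->|]; rewrite ?andbF.
have -> : \sum_(i | P i && ~~ Q i && R i) F i = \sum_(w | P w && R w) F w.
  apply: eq_bigl => w.
  by rewrite -andbA; case: (boolP (R w)) => [/excl ->|]; rewrite ?andbF.
have -> : \sum_(i | P i && ~~ Q i && ~~ R i) F i =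
    \sum_(w | [&& P w, ~~ Q w & ~~ R w]) F w.
  by apply: eq_bigl => w; rewrite andbA.
by ring.
Qed.

Lemma hess_perm_conj H (s t : 'I_n) w : twin n H s -> t = s.+1 :> nat ->
  hess_perm H (w ^ tperm s t)%g = hess_perm H w.
Proof.
move=> [_ Hst Hne] tE; set g := tperm s t.
have gH (j : 'I_n) : H (g j) = H j.
  by rewrite /g; case: tpermP => [->|->|]; rewrite ?tE.
have gle (k j : 'I_n) : (g k < H j)%N = (k < H j)%N.
  have := Hne j (ltn_ord j); rewrite /g; case: tpermP => [->|->|_ _] //; lia.
rewrite /hess_perm; apply/forallP/forallP => hw j.
  by have := hw (g j); rewrite conj_permE gH gle.
by rewrite -(permKV g j) conj_permE gH gle.
Qed.

Lemma hess_sum_row F : class_function F -> row_law n (hess_sum^~ F).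
Proof.
move=> cF H s v hH tw /andP[sv vn] Hs h0 h1.
have [sn Hst Hne] := tw.
pose s' := Ordinal (ltnW sn); pose t' := Ordinal sn; pose v' := Ordinal vn.
(* The bounds at the twins are [v + 1]; lowering one of them to [v] excludes exactly the
   permutations that send this twin to [v]. *)
pose Q (w : 'S_n) := w s' == v'; pose R (w : 'S_n) := w t' == v'.
have e0 w : hess_perm (upd H s v) w = hess_perm H w && ~~ Q w.
  rewrite hess_perm_upd ?Hs ?(ltnW sn) //.
  have [/forallP hw|//] := boolP (hess_perm H w).
  have := hw s'; rewrite /= Hs ltnS leq_eqVlt => hs.
  apply/forallP/idP => [/(_ s')|nQ j].
    by rewrite eqxx /= => lt; apply/eqP => e; rewrite e ltnn in lt.
  apply/implyP => /eqP js; have -> : j = s' by apply: val_inj.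
  by case/predU1P: hs => // e; case/eqP: nQ; apply: val_inj.
have e1 w : hess_perm (upd (upd H s v) s.+1 v) w = [&& hess_perm H w, ~~ Q w & ~~ R w].
  rewrite hess_perm_upd //; last by rewrite /upd; case: eqP; lia.
  rewrite e0 -andbA; have [/forallP hw|//] := boolP (hess_perm H w).
  case: (~~ Q w) => //=.
  have := hw t'; rewrite /= -Hst Hs ltnS leq_eqVlt => hs.
  apply/forallP/idP => [/(_ t')|nQ j].
    by rewrite eqxx /= => lt; apply/eqP => e; rewrite e ltnn in lt.
  apply/implyP => /eqP js; have -> : j = t' by apply: val_inj.
  by case/predU1P: hs => // e; case/eqP: nQ; apply: val_inj.
rewrite /hess_sum (eq_bigl _ _ e0) (eq_bigl _ _ e1).
have gv : tperm s' t' v' = v' by rewrite tpermD // -val_eqE /=; lia.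
apply: (sum_two_step (g := tperm s' t')) => // w.
- exact: hess_perm_conj.
- have := conj_permE w (tperm s' t') t'; rewrite tpermR /Q => ->.
  by rewrite -{1}gv (inj_eq perm_inj).
- apply: contraTN => /eqP ws; apply/eqP => wt; have := @perm_inj _ w s' t'.
  by rewrite ws wt => /(_ erefl) /(congr1 val) /=; lia.
Qed.

Lemma hess_sum_col F : class_function F -> col_law n (hess_sum^~ F).
Proof.
move=> cF H i s hH tw si Hi h0 h1.
have [sn Hst Hne] := tw.
have iN : (i < n)%N by lia.
pose s' := Ordinal (ltnW sn); pose t' := Ordinal sn; pose i' := Ordinal iN.
(* Lowering the bound at [i] from [s + 2] first excludes [w i = s + 1], then [w i = s]; conjugation
   with the transposition of the twins exchanges these. *)
pose Q (w : 'S_n) := w i' == t'; pose R (w : 'S_n) := w i' == s'.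
have eU x w : (x < s.+2)%N -> hess_perm (upd H i x) w = hess_perm H w && (w i' < x)%N.
  move=> xs; rewrite hess_perm_upd ?Hi //; congr (_ && _).
  apply/forallP/idP => [/(_ i')|lt j]; first by rewrite eqxx.
  by apply/implyP => /eqP ji; have -> : j = i' by apply: val_inj.
have e0 w : hess_perm (upd H i s.+1) w = hess_perm H w && ~~ Q w.
  rewrite eU //; have [/forallP/(_ i')|//] := boolP (hess_perm H w).
  by rewrite /= Hi /Q -val_eqE /=; lia.
have e1 w : hess_perm (upd H i s) w = [&& hess_perm H w, ~~ Q w & ~~ R w].
  rewrite eU; last by lia.
  have [/forallP/(_ i')|//] := boolP (hess_perm H w).
  by rewrite /= Hi /Q /R -!val_eqE /=; lia.
rewrite /hess_sum (eq_bigl _ _ e0) (eq_bigl _ _ e1).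
have gi : tperm s' t' i' = i' by rewrite tpermD // -val_eqE /=; lia.
apply: (sum_two_step (g := tperm s' t')) => // w.
- exact: hess_perm_conj.
- have := conj_permE w (tperm s' t') i'; rewrite gi /Q => ->.
  by rewrite -[X in _ == X](tpermL s' t') (inj_eq perm_inj).
- by apply: contraTN; rewrite /Q /R => /eqP ->; rewrite -val_eqE /=; lia.
Qed.

End ClassSums.

(** * Rational identities behind the modular law for words *)

Section LocalIdentities.
Local Open Scope ring_scope.

(** The contribution of a neighbour in column [b] to the residue at [z = a] of the product of the
    (z-b)/(z-b-1). For [a = b + 1] this factor provides the pole and leaves its numerator, which is
    1. *)
Definition phi (a b : nat) : rat :=
  if a == b.+1 then 1 else (a%:R - b%:R) / (a%:R - b%:R - 1).

Lemma phi_den (a b : nat) : a != b.+1 -> (a%:R - b%:R - 1 != 0 :> rat).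
Proof.
apply: contraNneq => e; rewrite -(eqr_nat rat) -natr1.
by apply/eqP; apply: subr0_eq; rewrite -e; ring.
Qed.

Lemma phi_neq a b : a != b.+1 -> phi a b = (a%:R - b%:R) / (a%:R - b%:R - 1).
Proof. by rewrite /phi => /negPf ->. Qed.

Lemma phiS a : phi a.+1 a = 1.
Proof. by rewrite /phi eqxx. Qed.

Lemma phi_eq a : phi a a = 0.
Proof. by rewrite /phi subrr mul0r; case: eqP => //; lia. Qed.

Lemma phi_ge0 a b : 0 <= phi a b.
Proof.
rewrite /phi; case: eqP => [_ //|ne].
rewrite -(addrA a%:R) -opprD natr1; have [lt|ge] := ltnP b a.
  by apply: divr_ge0; rewrite subr_ge0 ler_nat; lia.
by apply: mulr_le0; rewrite ?invr_le0 subr_le0 ler_nat; lia.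
Qed.

(** Both edges, plus no edge, minus twice one edge: the factors at a vertex in column [z] to the
    right of twins in columns [a] and [b]. [V] says whether [z] is allowed to it without the
    twins. *)
Definition row_term (a b z : nat) (V : bool) : rat :=
  [|| V, a.+1 == z | b.+1 == z]%:R * phi z a * phi z b + V%:R
  - 2 * ((V || (b.+1 == z))%:R * phi z b).

(** Exchanging the columns of the twins cancels the defect of the row law. The hypotheses say that a
    pole comes from one neighbour only; the cases are those where [phi] takes its exceptional
    value. *)
Lemma row_local (a b z : nat) (A B V : bool) :
    (b = a.+1 -> B = false) -> (a = b.+1 -> A = false) ->
    (z = a.+1 -> V = false) -> (z = b.+1 -> V = false) ->
  phi b a * (A%:R * (B || (a.+1 == b))%:R * row_term a b z V)
  + phi a b * (B%:R * (A || (b.+1 == a))%:R * row_term b a z V) = 0.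
Proof.
move=> hB hA hVa hVb; rewrite /row_term.
have [e|nab] := eqVneq b a.+1.
  rewrite (hB e); subst b; rewrite phiS !mulr0n !mul0r mulr0 addr0 mul1r orbT.
  have [e1|nza] := eqVneq z a.+1.
    by rewrite (hVa e1); subst z; rewrite phi_eq !mulr0n; move: (A%:R : rat) (B%:R : rat) => A0 B0; ring.
  have [e1|nzb] := eqVneq z a.+2.
    rewrite (hVb e1); subst z; rewrite phiS phi_neq; last by lia.
    rewrite !orbT !mulr0n !mulr1n -(natr1 a.+1) -(natr1 a).
    have -> : (a%:R + 1 + 1 - a%:R - 1 = 1 :> rat) by ring.
    by move: (a%:R : rat) (A%:R : rat) (B%:R : rat) => x0 A0 B0; field.
  rewrite !orbF !phi_neq //.
  have := phi_den nza; have := phi_den nzb; rewrite -!(natr1 a).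
  by case: (A); case: (V) => /= h1 h2; field; rewrite ?h1 ?h2.
have [e|nba] := eqVneq a b.+1.
  rewrite (hA e); subst a; rewrite phiS !mulr0n !mul0r mulr0 add0r mul1r orbT.
  have [e1|nza] := eqVneq z b.+1.
    by rewrite (hVb e1); subst z; rewrite phi_eq !mulr0n; move: (A%:R : rat) (B%:R : rat) => A0 B0; ring.
  have [e1|nzb] := eqVneq z b.+2.
    rewrite (hVa e1); subst z; rewrite phiS phi_neq; last by lia.
    rewrite !orbT !mulr0n !mulr1n -(natr1 b.+1) -(natr1 b).
    have -> : (b%:R + 1 + 1 - b%:R - 1 = 1 :> rat) by ring.
    by move: (b%:R : rat) (A%:R : rat) (B%:R : rat) => x0 A0 B0; field.
  rewrite !orbF !phi_neq //.
  have := phi_den nza; have := phi_den nzb; rewrite -!(natr1 b).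
  by case: (B); case: (V) => /= h1 h2; field; rewrite ?h1 ?h2.
rewrite !orbF.
have dab := phi_den nab; have dba := phi_den nba.
suff key : phi b a * row_term a b z V + phi a b * row_term b a z V = 0.
  rewrite (mulrC B%:R) !(mulrCA _ (A%:R * B%:R)) -mulrDr.
  by rewrite /row_term in key; rewrite key mulr0.
rewrite /row_term.
have [e|nza] := eqVneq z a.+1.
  rewrite (hVa e); subst z; rewrite eqSS.
  have [->|ne] := eqVneq a b; first by rewrite !phi_eq !mul0r addr0.
  have nz : a%:R - b%:R != 0 :> rat by rewrite subr_eq0 eqr_nat.
  rewrite (phi_neq nab) (phi_neq nba) phiS (phi_neq (a := a.+1)) ?eqSS //.
  rewrite !mulr0n !mulr1n -!(natr1 a).
  move: (a%:R : rat) (b%:R : rat) nz dab dba => x y nz h1 h2.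
  have -> : x + 1 - y - 1 = x - y by ring.
  by field; rewrite h1 h2 nz.
have [e|nzb] := eqVneq z b.+1.
  rewrite (hVb e); subst z.
  have [->|ne] := eqVneq a b; first by rewrite !phi_eq !mul0r addr0.
  have nz : b%:R - a%:R != 0 :> rat by rewrite subr_eq0 eqr_nat eq_sym.
  rewrite (phi_neq nab) (phi_neq nba) phiS (phi_neq (a := b.+1)) ?eqSS 1?eq_sym //.
  rewrite !mulr0n !mulr1n -!(natr1 b).
  move: (a%:R : rat) (b%:R : rat) nz dab dba => x y nz h1 h2.
  have -> : y + 1 - x - 1 = y - x by ring.
  by field; rewrite h1 h2 nz.
have dza := phi_den nza; have dzb := phi_den nzb.
rewrite !orbF !phi_neq //.
move: (a%:R : rat) (b%:R : rat) (z%:R : rat) (V%:R : rat) dza dzb dab dba => x y u W h1 h2 h3 h4.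
by field; rewrite h1 h2 h3 h4.
Qed.

End LocalIdentities.

Section LocalIdentities2.
Local Open Scope ring_scope.

(** The analogous combination for a vertex in column [x] to the left of the twins. [A] and [B] say
    whether [a] and [b] are allowed without this vertex and without the other twin. *)
Definition col_term (a b x : nat) (A B : bool) : rat :=
  (A || (x.+1 == a))%:R * [|| B, x.+1 == b | a.+1 == b]%:R * phi a x * phi b x
  + A%:R * (B || (a.+1 == b))%:R
  - 2 * ((A || (x.+1 == a))%:R * (B || (a.+1 == b))%:R * phi a x).

Lemma col_local (a b x : nat) (A B : bool) :
    (b = a.+1 -> B = false) -> (a = b.+1 -> A = false) ->
    (a = x.+1 -> A = false) -> (b = x.+1 -> B = false) ->
  phi b a * col_term a b x A B + phi a b * col_term b a x B A = 0.
Proof.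
move=> hB hA hAx hBx; rewrite /col_term.
have [e|nab] := eqVneq b a.+1.
  have B0 := hB e; subst b B; rewrite phiS.
  have -> : (a.+2 == a) = false by lia.
  have [e|nax] := eqVneq a x.
    subst x; rewrite eqxx phi_eq phiS phi_neq; last by lia.
    have -> : (a.+1 == a) = false by lia.
    rewrite !orbF !orbT !mulr0n !mulr1n -!(natr1 a).
    have -> : a%:R - (a%:R + 1) - 1 = - 2 :> rat by ring.
    by move: (a%:R : rat) (A%:R : rat) => x0 A0; field.
  rewrite eqSS (eq_sym x) (negPf nax) !orbF !orbT.
  have [e|nax1] := eqVneq a x.+1.
    rewrite (hAx e); subst a; rewrite phiS phi_neq ?eqSS //.
    rewrite !mulr0n !mulr1n -!(natr1 x.+1) -!(natr1 x).
    have -> : x%:R + 1 + 1 - x%:R - 1 = 1 :> rat by ring.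
    by move: (x%:R : rat) => x0; field.
  rewrite !orbF (phi_neq nax1) phi_neq ?eqSS //.
  have := phi_den nax1; have nz : (a%:R - x%:R != 0 :> rat) by rewrite subr_eq0 eqr_nat.
  rewrite !mulr0n !mulr1n -!(natr1 a) => h.
  have -> : (a%:R + 1 - x%:R - 1 = a%:R - x%:R :> rat) by ring.
  move: (a%:R : rat) (x%:R : rat) (A%:R : rat) h nz => x0 y0 A0 h nz.
  by field; rewrite h nz.
have [e|nba] := eqVneq a b.+1.
  have B0 := hA e; subst a A; rewrite phiS.
  have [e|nax] := eqVneq b x.
    subst x; rewrite eqxx phi_eq phiS phi_neq; last by lia.
    have -> : (b.+1 == b) = false by lia.
    rewrite !orbF !orbT !mulr0n !mulr1n -!(natr1 b).
    have -> : b%:R - (b%:R + 1) - 1 = - 2 :> rat by ring.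
    by move: (b%:R : rat) (B%:R : rat) => x0 A0; field.
  rewrite eqSS (eq_sym x) (negPf nax) !orbF !orbT.
  have [e|nax1] := eqVneq b x.+1.
    rewrite (hBx e); subst b; rewrite phiS (phi_neq (a := x.+2) (b := x)) ?eqSS //.
    rewrite !mulr0n !mulr1n -!(natr1 x.+1) -!(natr1 x).
    have -> : x%:R + 1 + 1 - x%:R - 1 = 1 :> rat by ring.
    by move: (x%:R : rat) => x0; field.
  rewrite !orbF (phi_neq nax1) (phi_neq (a := b.+1) (b := x)) ?eqSS //.
  have := phi_den nax1; have nz : (b%:R - x%:R != 0 :> rat) by rewrite subr_eq0 eqr_nat.
  rewrite !mulr0n !mulr1n -!(natr1 b) => h.
  have -> : (b%:R + 1 - x%:R - 1 = b%:R - x%:R :> rat) by ring.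
  move: (b%:R : rat) (x%:R : rat) (B%:R : rat) h nz => x0 y0 A0 h nz.
  by field; rewrite h nz.
rewrite !orbF.
have dab := phi_den nab; have dba := phi_den nba.
have [e|ab] := eqVneq a b.
  by subst b; rewrite !phi_eq !mul0r addr0.
have [e|nax] := eqVneq a x.+1.
  rewrite (hAx e); subst a.
  rewrite ?(eq_sym b) ?(negPf ab) !orbF phiS !mulr0n !mulr1n.
  have nbx : b != x.+1 by rewrite eq_sym.
  have dbx := phi_den nbx.
  rewrite (phi_neq nbx) (phi_neq nab) (phi_neq nba).
  move: dab dba; rewrite -!(natr1 x).
  move: (b%:R : rat) (x%:R : rat) (B%:R : rat) dbx => u v B0 h h1 h2.
  by field; rewrite h h1 h2.
have [e|nbx] := eqVneq b x.+1.
  rewrite (hBx e); subst b.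
  rewrite ?(negPf ab) !orbF phiS !mulr0n !mulr1n.
  have dax := phi_den nax.
  rewrite (phi_neq nax) (phi_neq nab) (phi_neq nba).
  move: dab dba; rewrite -!(natr1 x).
  move: (a%:R : rat) (x%:R : rat) (A%:R : rat) dax => u v A0 h h1 h2.
  by field; rewrite h h1 h2.
have dax := phi_den nax; have dbx := phi_den nbx.
rewrite !orbF !phi_neq //.
move: (a%:R : rat) (b%:R : rat) (x%:R : rat) (A%:R : rat) (B%:R : rat) dab dba dax dbx.
move=> u v t A0 B0 h1 h2 h3 h4.
by field; rewrite h1 h2 h3 h4.
Qed.
End LocalIdentities2.

(** * Weighted sums over words and their modular law *)

Section Words.
Local Open Scope ring_scope.
Variable n : nat.
Notation word := {ffun 'I_n -> 'I_n}.
Implicit Types (H : nat -> nat) (c : word) (w : 'S_n).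

Definition adj H (i v : 'I_n) : bool := ((i < v) && (v < H i))%N.

(** The column of [v] is a pole of the rational function whose residues are the probabilities. *)
Definition col_ok H c (v : 'I_n) : bool :=
  (c v == 0 :> nat) || [exists i, adj H i v && ((c i).+1 == c v :> nat)].

(** The product of the residues. The denominator [maxn 1 (c v)] comes from the factor 1/z, which at
    z = 0 is the pole itself and contributes 1. *)
Definition word_wt H c : rat :=
  \prod_v ((col_ok H c v)%:R / (maxn 1 (c v))%:R
           * \prod_(i | adj H i v) phi (c v) (c i)).

(** The row of [i] when the vertices are stacked in their columns in increasing order. *)
Definition height c (i : 'I_n) : nat := #|[set k : 'I_n | (k < i)%N && (c k == c i)]|.

Definition row_stab c w : bool := [forall i, height c (w i) == height c i].

Definition row_sum c (F : 'S_n -> rat) : rat := \sum_(w | row_stab c w) F w.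

Definition word_sum H (F : 'S_n -> rat) : rat := \sum_c word_wt H c * row_sum c F.

Lemma word_wt_ge0 H c : 0 <= word_wt H c.
Proof.
apply: prodr_ge0 => v _; apply: mulr_ge0; last by apply: prodr_ge0 => i _; apply: phi_ge0.
by apply: divr_ge0; apply: ler0n.
Qed.

Lemma word_sum_ext F H H' :
  (forall i, (i < n)%N -> H i = H' i) -> word_sum H F = word_sum H' F.
Proof.
move=> eqH; apply: eq_bigr => c _; congr (_ * _); apply: eq_bigr => v _.
have eqa i : adj H i v = adj H' i v by rewrite /adj eqH.
congr (_%:R / _ * _); last by apply: eq_bigl.
by congr (_ || _); apply: eq_existsb => i; rewrite eqa.
Qed.

Definition wcomp c (g : 'S_n) : word := [ffun i => c (g i)].

Lemma wcompE c (g : 'S_n) i : wcomp c g i = c (g i).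
Proof. by rewrite ffunE. Qed.

Section Swap.
Variables (s t : 'I_n).
Hypothesis st : t = s.+1 :> nat.
Let g := tperm s t.

Let gs : g s = t. Proof. exact: tpermL. Qed.
Let gt : g t = s. Proof. exact: tpermR. Qed.
Let gD i : i != s -> i != t -> g i = i.
Proof. by move=> h1 h2; apply: tpermD; rewrite eq_sym. Qed.
Let gK : involutive g. Proof. exact: tpermK. Qed.

Let g_eqs k : (g k == s) = (k == t).
Proof. by rewrite -{1}gt (inj_eq perm_inj). Qed.
Let g_eqt k : (g k == t) = (k == s).
Proof. by rewrite -{1}gs (inj_eq perm_inj). Qed.

Lemma wcompK : involutive (wcomp^~ g).
Proof. by move=> c; apply/ffunP => i; rewrite !wcompE gK. Qed.

Let gval i : g i = (if i == s :> nat then s.+1 else if i == s.+1 :> nat then s : nat else i) :> nat.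
Proof.
rewrite /g; case: tpermP => [->|->|h1 h2].
- by rewrite eqxx.
- by rewrite st eqxx; case: eqP; lia.
- by case: eqP => [/val_inj //|_]; rewrite -st; case: eqP => [/val_inj|].
Qed.

Lemma swap_ltn (k i : 'I_n) : ~~ ((k == s) && (i == t)) -> (k < i)%N -> (g k < g i)%N.
Proof. by rewrite -!val_eqE /= !gval st; do 4?[case: eqP]; lia. Qed.

(** The transposition reverses the order of the pair [s], [t] only, and these two lie in different
    columns. *)
Lemma height_swap c i : c s != c t -> height (wcomp c g) i = height c (g i).
Proof.
move=> ne; rewrite /height -(card_imset _ (@perm_inj _ g)).
apply: eq_card => k; rewrite !inE.
apply/imsetP/andP => [[k' + ->]|[kl /eqP ck]].
  rewrite inE !wcompE => /andP[lt /eqP ce]; rewrite ce; split=> //.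
  apply: swap_ltn lt; apply/negP => /andP[/eqP ks /eqP it].
  by move: ce ne; rewrite ks it gs gt => ->; rewrite eqxx.
exists (g k); last by rewrite gK.
rewrite inE !wcompE gK ck eqxx andbT -[X in (_ < nat_of_ord X)%N]gK.
apply: swap_ltn kl; apply/negP => /andP[/eqP ks /eqP it].
by move: ck ne; rewrite ks it => ->; rewrite eqxx.
Qed.

Lemma row_sum_swap c F : class_function F -> row_sum (wcomp c g) F = row_sum c F.
Proof.
move=> cF; have [e|ne] := eqVneq (c s) (c t).
  congr row_sum; apply/ffunP => i; rewrite wcompE /g.
  by case: tpermP => [->|->|].
apply: (sum_conj (g := g)) => // w; apply/forallP/forallP => h i.
  by have := h (g i); rewrite conj_permE !height_swap // !gK.
by rewrite -(gK i) conj_permE !height_swap // !gK.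
Qed.

Section Base.
Variable H : nat -> nat.
Hypotheses (tw : twin n H s) (ht : (t < H s)%N).

Let HE i : H (g i) = H i.
Proof.
by have [_ e _] := tw; rewrite /g; case: tpermP => [->|->|//]; rewrite st e.
Qed.

Let gle (j i : 'I_n) : (g j < H i)%N = (j < H i)%N.
Proof.
have [_ _ /(_ i (ltn_ord i)) hne] := tw; rewrite gval.
by do 2?[case: eqP]; lia.
Qed.

Lemma adj_swap i j :
    ~~ ((i == s) && (j == t)) -> ~~ ((i == t) && (j == s)) ->
  adj H (g i) (g j) = adj H i j.
Proof.
move=> h1 h2; rewrite /adj HE gle; congr (_ && _).
apply/idP/idP => [lt|]; last exact: swap_ltn.
rewrite -(gK i) -(gK j); apply: swap_ltn lt.
by rewrite g_eqs g_eqt.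
Qed.

Lemma adj_st : adj H s t.
Proof. by rewrite /adj st ltnSn -st. Qed.

Lemma adj_t i : i != s -> adj H i t = adj H i s.
Proof.
rewrite -val_eqE /= /adj st => nis; have [_ _ /(_ i (ltn_ord i))] := tw.
by have := ltn_ord i; lia.
Qed.

(** The edge between the twins is left out because its factor alone is not symmetric under their
    exchange. *)
Definition rest_wt c : rat :=
  \prod_(p : 'I_n * 'I_n | adj H p.1 p.2 && (p != (s, t))) phi (c p.2) (c p.1).

Lemma edge_twin c : \prod_(p : 'I_n * 'I_n | adj H p.1 p.2) phi (c p.2) (c p.1)
  = phi (c t) (c s) * rest_wt c.
Proof. by rewrite (bigD1 (s, t)) //=; apply: adj_st. Qed.

Lemma rest_swap c : rest_wt (wcomp c g) = rest_wt c.
Proof.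
rewrite /rest_wt (reindex_inj (h := fun p => (g p.1, g p.2))) /=; last first.
  by move=> [i j] [k l] /= [/perm_inj -> /perm_inj ->].
apply: eq_big => [[i j]|[i j] _] /=; last by rewrite !wcompE !gK.
rewrite !xpair_eqE.
have [/andP[/eqP-> /eqP->]|h1] := boolP ((i == s) && (j == t)).
  by rewrite gs gt andbF /adj; have -> : (t < s)%N = false by lia.
have [/andP[/eqP-> /eqP->]|h2] := boolP ((i == t) && (j == s)).
  by rewrite gs gt !eqxx /= andbF /adj; have -> : (t < s)%N = false by lia.
rewrite adj_swap //; congr (_ && _).
by rewrite g_eqs g_eqt.
Qed.

Lemma rest_neq c i j : rest_wt c != 0 -> adj H i j -> (i, j) != (s, t) -> c i != c j.
Proof.
move=> nz aij ne; apply: contra_neq nz => e; apply/eqP/prodf_eq0.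
by exists (i, j); rewrite ?aij //= e phi_eq.
Qed.

(** Availability of column [a] to either twin through the left neighbours of [s], which are those of
    [t] other than [s]. *)
Definition left_ok c (a : nat) : bool :=
  (a == 0)%N || [exists i, adj H i s && ((c i).+1 == a :> nat)].

Lemma left_ok_swap c a : left_ok (wcomp c g) a = left_ok c a.
Proof.
congr (_ || _); apply: eq_existsb => i; rewrite wcompE.
have [/andP[lti _]|//] := boolP (adj H i s).
by rewrite gD // -val_eqE /=; lia.
Qed.

Lemma col_ok_s c : col_ok H c s = left_ok c (c s).
Proof. by []. Qed.

Lemma col_ok_t c : col_ok H c t = left_ok c (c t) || ((c s).+1 == c t :> nat).
Proof.
rewrite /col_ok /left_ok -orbA; congr (_ || _).
apply/existsP/orP => [[i /andP[ai ci]]|[/existsP[i /andP[ai ci]]|cs]].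
- have [e|ne] := eqVneq i s; [by right; rewrite -e | left; apply/existsP; exists i].
  by rewrite -adj_t // ai.
- exists i; rewrite adj_t ?ai ?ci //.
  by apply: contraTneq ai => ->; rewrite /adj ltnn.
- by exists s; rewrite adj_st.
Qed.

Lemma col_ok_swap c v : v != s -> v != t -> col_ok H (wcomp c g) v = col_ok H c v.
Proof.
move=> vs vt; rewrite /col_ok wcompE gD //; congr (_ || _).
have key i : adj H (g i) v = adj H i v.
  by rewrite -[X in adj H (g i) X](gD vs vt) adj_swap // (negPf vs, negPf vt) ?andbF ?(negPf vs) ?(negPf vt) ?andbF.
apply/existsP/existsP => -[i /andP[ai ci]]; exists (g i).
  by rewrite key ai -wcompE.
by rewrite key ai wcompE gK.
Qed.

(** A left neighbour allowing the column [c s + 1] would lie in column [c s], but it is adjacent to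
    [s]. *)
Lemma left_ok_succ c : rest_wt c != 0 -> c t = (c s).+1 :> nat -> left_ok c (c t) = false.
Proof.
move=> nz e; rewrite /left_ok e /=; apply/negbTE/existsPn => i.
apply/negP => /andP[ai /eqP[/val_inj ci]].
have /eqP[] : c i != c s; last exact: ci.
apply: rest_neq nz ai _; rewrite xpair_eqE -[X in _ && X]val_eqE /= st.
by rewrite negb_and; apply/orP; right; lia.
Qed.

Lemma left_ok_pred c : rest_wt c != 0 -> c s = (c t).+1 :> nat -> left_ok c (c s) = false.
Proof.
move=> nz e; rewrite -(left_ok_swap c).
have := @left_ok_succ (wcomp c g); rewrite rest_swap !wcompE gs gt; exact.
Qed.

End Base.

Definition const_wt c : rat := \prod_v ((maxn 1 (c v))%:R)^-1.

Lemma const_swap c : const_wt (wcomp c g) = const_wt c.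
Proof.
rewrite /const_wt (reindex_inj (@perm_inj _ g)); apply: eq_bigr => v _.
by rewrite wcompE gK.
Qed.

Lemma word_wtE H c : word_wt H c =
  const_wt c * (\prod_v (col_ok H c v)%:R)
   * \prod_(p : 'I_n * 'I_n | adj H p.1 p.2) phi (c p.2) (c p.1).
Proof.
rewrite /word_wt !big_split /=; congr (_ * _); first by rewrite mulrC.
by rewrite (exchange_big_dep xpredT) //= pair_big_dep.
Qed.

(** Adding the defect of the law to its reindexing by the exchange of [s] and [t] gives twice the
    defect, so it suffices that it cancels on each pair [c], [wcomp c g]. *)
Lemma word_sum_law H0 H1 H2 F : class_function F ->
    (forall c, word_wt H0 c + word_wt H2 c - 2 * word_wt H1 c
      + (word_wt H0 (wcomp c g) + word_wt H2 (wcomp c g)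
         - 2 * word_wt H1 (wcomp c g)) = 0) ->
  word_sum H0 F + word_sum H2 F = 2 * word_sum H1 F.
Proof.
move=> cF hT; apply/eqP; rewrite -subr_eq0 /word_sum mulr_sumr -big_split -sumrB /=.
set T := \sum_c _; suff : T + T = 0 by move=> h; apply/eqP; lra.
rewrite {2}/T (reindex_inj (inv_inj wcompK)) -big_split big1 //= => c _.
rewrite row_sum_swap // !(mulrA 2) -!mulrDl -!mulrBl -mulrDl hT mul0r //.
Qed.

Definition edge_wt H c : rat :=
  \prod_(p : 'I_n * 'I_n | adj H p.1 p.2) phi (c p.2) (c p.1).

Section Remove.
Variables (H H' : nat -> nat) (i0 j0 : 'I_n).
Hypotheses (adjE : forall i j, adj H' i j = adj H i j && ((i, j) != (i0, j0)))
           (adj0 : adj H i0 j0).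

Lemma edge_remove c : edge_wt H c = phi (c j0) (c i0) * edge_wt H' c.
Proof.
rewrite /edge_wt (bigD1 (i0, j0)) //=; congr (_ * _).
by apply: eq_bigl => -[i j]; rewrite adjE.
Qed.

Lemma col_ok_remove c u : u != j0 -> col_ok H c u = col_ok H' c u.
Proof.
move=> ne; congr (_ || _); apply: eq_existsb => i.
by rewrite adjE xpair_eqE (negPf ne) andbF andbT.
Qed.

Lemma col_ok_remove0 c : col_ok H c j0 = col_ok H' c j0 || ((c i0).+1 == c j0 :> nat).
Proof.
rewrite /col_ok -orbA; congr (_ || _).
apply/existsP/orP => [[i /andP[ai ci]]|[/existsP[i]|ci]].
- have [e|ne] := eqVneq i i0; [by right; rewrite -e | left; apply/existsP; exists i].
  by rewrite adjE ai xpair_eqE (negPf ne).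
- by rewrite adjE => /andP[/andP[ai _] ci]; exists i; rewrite ai.
- by exists i0; rewrite adj0.
Qed.
End Remove.

Lemma adj_upd H (i0 j0 : 'I_n) : H i0 = j0.+1 ->
  forall i j, adj (upd H i0 j0) i j = adj H i j && ((i, j) != (i0, j0)).
Proof.
move=> e i j; rewrite /adj /upd xpair_eqE -!val_eqE /=.
by case: eqP => [->|_]; rewrite ?andbT //= e; lia.
Qed.

(** After a factor common to the three functions and to both words is taken out, this is [row_local]
    at the columns of the twins and of [v]. *)
Lemma row_pointwise H (v : 'I_n) c : twin n H s -> (t < v)%N -> H s = v.+1 ->
    hess n (upd H s v) ->
  let H1 := upd H s v in let H2 := upd (upd H s v) s.+1 v in
  word_wt H c + word_wt H2 c - 2 * word_wt H1 c
  + (word_wt H (wcomp c g) + word_wt H2 (wcomp c g)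
     - 2 * word_wt H1 (wcomp c g)) = 0.
Proof.
move=> [tn Hst Hne] tv Hs hH1 H1 H2.
have adj1 := @adj_upd H s v Hs; rewrite -/H1 in adj1.
have H1t : H1 t = v.+1 by rewrite /H1 /upd st -Hst Hs; case: eqP => //; lia.
have adj2 := @adj_upd H1 t v H1t; rewrite st -/H2 in adj2.
have H2s : H2 s = v by rewrite /H2 /upd eqxx; case: eqP; lia.
have a1 : adj H s v by rewrite /adj Hs; lia.
have a2 : adj H1 t v by rewrite /adj H1t; lia.
have tw2 : twin n H2 s.
  split=> //; first by rewrite H2s /H2 /upd eqxx.
  move=> j jn; rewrite /H2 /H1 /upd; case: (j =P s.+1) => _; first by lia.
  by case: (j =P s) => _; [lia | apply: Hne].
have ht2 : (t < H2 s)%N by rewrite H2s.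
have sv : s != v by rewrite -val_eqE /=; lia.
have tv' : t != v by rewrite -val_eqE /=; lia.
have ts : t != s by rewrite -val_eqE /=; lia.
have vs : v != s by rewrite eq_sym.
have vt : v != t by rewrite eq_sym.
pose okr d := \prod_(u | (u != s) && (u != t) && (u != v)) (col_ok H2 d u)%:R : rat.
have okprod K d : (forall u, u != v -> col_ok K d u = col_ok H2 d u) ->
    \prod_u (col_ok K d u)%:R = ((left_ok H2 d (d s))%:R
      * (left_ok H2 d (d t) || ((d s).+1 == d t :> nat))%:R
      * (col_ok K d v)%:R * okr d :> rat).
  move=> eqK; rewrite (bigD1 s) //= (bigD1 t) //= (bigD1 v) ?(eq_sym v) ?sv ?tv' //=.
  rewrite (eqK s) // (eqK t) // col_ok_s (col_ok_t tw2 ht2) !mulrA; congr (_ * _).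
  by apply: eq_bigr => u /andP[_ uv]; rewrite eqK.
have eq1 d u : u != v -> col_ok H1 d u = col_ok H2 d u.
  exact: (col_ok_remove adj2).
have eq0 d u : u != v -> col_ok H d u = col_ok H2 d u.
  by move=> uv; rewrite (col_ok_remove adj1) // eq1.
pose cf d := const_wt d * rest_wt H2 d * okr d.
have T d : word_wt H d + word_wt H2 d - 2 * word_wt H1 d =
    cf d * (phi (d t) (d s) * ((left_ok H2 d (d s))%:R
      * (left_ok H2 d (d t) || ((d s).+1 == d t :> nat))%:R
      * row_term (d s) (d t) (d v) (col_ok H2 d v))).
  rewrite !word_wtE -!/(edge_wt _ d) (edge_remove adj1 a1) (edge_remove adj2 a2).
  rewrite [edge_wt H2 d](edge_twin ht2) (okprod H d (eq0 d)) (okprod H1 d (eq1 d)) (okprod H2 d) //.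
  rewrite (col_ok_remove0 adj1 a1) (col_ok_remove0 adj2 a2).
  rewrite /cf /row_term -orbA (orbC (_ == _) (_ == _)).
  move: (const_wt d) (rest_wt H2 d) (okr d) => x1 x2 x3.
  by move: (_%:R : rat) (_%:R : rat) (_%:R : rat) (_%:R : rat) (_%:R : rat) => y1 y2 y3 y4 y5; ring.
rewrite !T /cf const_swap rest_swap // !wcompE gs gt (gD vs vt).
have -> : okr (wcomp c g) = okr c.
  by apply: eq_bigr => u /andP[/andP[us ut] _]; rewrite col_ok_swap //.
rewrite !left_ok_swap // col_ok_swap // -mulrDr.
have [->|nz] := eqVneq (rest_wt H2 c) 0; first by rewrite mulr0 !mul0r.
(* Without the twins, the left neighbours of [v] lie strictly between [t] and [v]. They are
   therefore adjacent to both twins and differ from them in column. *)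
have nocol (k : 'I_n) : adj H2 k v -> c k != c s /\ c k != c t.
  move=> ak; have [kt|tk] := leqP k t.
    suff : (H2 k <= v)%N by move: ak; rewrite /adj; lia.
    rewrite /H2 /upd; case: eqP => // kt'; case: eqP => // ks.
    have ks' : (k <= s)%N by lia.
    have := hH1.2 _ _ ks' (ltn_ord s).
    by rewrite /H1 /upd eqxx; case: eqP.
  have kv : (k < v)%N by case/andP: ak.
  split; rewrite eq_sym; apply: (rest_neq nz).
  - by rewrite /adj H2s; lia.
  - by rewrite xpair_eqE negb_and; apply/orP; right; rewrite -val_eqE /=; lia.
  - by rewrite /adj (_ : H2 t = v) ?st /H2 /upd ?eqxx //; lia.
  - by rewrite xpair_eqE (negPf ts).
apply/eqP; rewrite mulf_eq0; apply/orP; right; apply/eqP.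
apply: row_local.
- exact: left_ok_succ.
- exact: left_ok_pred.
- move=> e; rewrite /col_ok e /=; apply/negbTE/negP => /existsP[k /andP[/nocol[ks _] /eqP[/val_inj ck]]].
  by rewrite ck eqxx in ks.
- move=> e; rewrite /col_ok e /=; apply/negbTE/negP => /existsP[k /andP[/nocol[_ kt] /eqP[/val_inj ck]]].
  by rewrite ck eqxx in kt.
Qed.

Lemma col_pointwise H (i0 : 'I_n) c : twin n H s -> (i0 < s)%N -> H i0 = s.+2 ->
    hess n (upd H i0 s) ->
  let H1 := upd H i0 s.+1 in let H2 := upd H i0 s in
  word_wt H c + word_wt H2 c - 2 * word_wt H1 c
  + (word_wt H (wcomp c g) + word_wt H2 (wcomp c g)
     - 2 * word_wt H1 (wcomp c g)) = 0.
Proof.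
move=> [tn Hst Hne] is0 Hi hH2 H1 H2.
have Hit : H i0 = t.+1 by rewrite Hi st.
have adj1 := @adj_upd H i0 t Hit; rewrite st -/H1 in adj1.
have H1i : H1 i0 = s.+1 by rewrite /H1 /upd eqxx.
have adj2 i j : adj H2 i j = adj H1 i j && ((i, j) != (i0, s)).
  rewrite -(adj_upd H1i) /adj /H2 /H1 /upd.
  by case: (i =P i0 :> nat).
have H2i : H2 i0 = s by rewrite /H2 /upd eqxx.
have a1 : adj H i0 t by rewrite /adj Hi; lia.
have a2 : adj H1 i0 s by rewrite /adj H1i; lia.
have H2s : H2 s = H s by rewrite /H2 /upd; case: eqP => //; lia.
have H2t : H2 t = H t by rewrite /H2 /upd; case: eqP => //; lia.
have tw2 : twin n H2 s.
  split=> //; first by rewrite -st H2t H2s st.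
  move=> j jn; rewrite /H2 /upd; case: (j =P i0 :> nat) => _; first by lia.
  exact: Hne.
have ht2 : (t < H2 s)%N.
  by have := hH2.1 t (ltn_ord t); rewrite -/H2 H2t H2s Hst -st => /andP[].
have is_ : i0 != s by rewrite -val_eqE /=; lia.
have it : i0 != t by rewrite -val_eqE /=; lia.
have ts : t != s by rewrite -val_eqE /=; lia.
have st' : s != t by rewrite eq_sym.
pose okr d := \prod_(u | (u != s) && (u != t)) (col_ok H2 d u)%:R : rat.
have okprod K d : (forall u, u != s -> u != t -> col_ok K d u = col_ok H2 d u) ->
    \prod_u (col_ok K d u)%:R = ((col_ok K d s)%:R * (col_ok K d t)%:R * okr d :> rat).
  move=> eqK; rewrite (bigD1 s) //= (bigD1 t) //= mulrA; congr (_ * _).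
  by apply: eq_bigr => u /andP[us ut]; rewrite eqK.
have eq1 d u : u != s -> u != t -> col_ok H1 d u = col_ok H2 d u.
  by move=> us _; apply: (col_ok_remove adj2).
have eq0 d u : u != s -> u != t -> col_ok H d u = col_ok H2 d u.
  by move=> us ut; rewrite (col_ok_remove adj1) // eq1.
pose cf d := const_wt d * rest_wt H2 d * okr d.
have T d : word_wt H d + word_wt H2 d - 2 * word_wt H1 d =
    cf d * (phi (d t) (d s) * col_term (d s) (d t) (d i0)
                                (left_ok H2 d (d s)) (left_ok H2 d (d t))).
  rewrite !word_wtE -!/(edge_wt _ d) (edge_remove adj1 a1) (edge_remove adj2 a2).
  rewrite [edge_wt H2 d](edge_twin ht2).
  rewrite (okprod H d (eq0 d)) (okprod H1 d (eq1 d)) (okprod H2 d) //.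
  rewrite (col_ok_remove adj1) // (col_ok_remove0 adj1 a1).
  rewrite (col_ok_remove0 adj2 a2) (col_ok_remove adj2 d ts).
  rewrite (col_ok_t tw2 ht2) col_ok_s.
  rewrite /cf /col_term -orbA (orbC ((d s).+1 == _) ((d i0).+1 == _)).
  move: (const_wt d) (rest_wt H2 d) (okr d) => x1 x2 x3.
  by move: (_%:R : rat) (_%:R : rat) (_%:R : rat) (_%:R : rat) (_%:R : rat) => y1 y2 y3 y4 y5; ring.
rewrite !T /cf const_swap rest_swap // !wcompE gs gt (gD is_ it).
have -> : okr (wcomp c g) = okr c.
  by apply: eq_bigr => u /andP[us ut]; rewrite col_ok_swap.
rewrite !left_ok_swap // -mulrDr.
have [->|nz] := eqVneq (rest_wt H2 c) 0; first by rewrite mulr0 !mul0r.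
(* In [H2] the vertex [i0] reaches everything before [s], and vertices up to [i0] do not reach [s];
   so the left neighbours of [s] are neighbours of [i0]. *)
have nocol (k : 'I_n) : adj H2 k s -> c i0 != c k.
  move=> ak; have [ki|ik] := leqP k i0.
    have := hH2.2 _ _ ki (ltn_ord i0); rewrite -/H2 H2i.
    by move: ak; rewrite /adj; lia.
  apply: (rest_neq nz); first by move: ak; rewrite /adj H2i ik; lia.
  by rewrite xpair_eqE (negPf is_).
apply/eqP; rewrite mulf_eq0; apply/orP; right; apply/eqP.
have nol a : a = (c i0).+1 -> left_ok H2 c a = false.
  move=> e; rewrite /left_ok e /=; apply/negbTE/negP => /existsP[k /andP[/nocol ks /eqP[/val_inj ck]]].
  by rewrite ck eqxx in ks.
apply: col_local.
- exact: left_ok_succ.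
- exact: left_ok_pred.
- exact: nol.
- exact: nol.
Qed.

End Swap.

Lemma word_sum_row F : class_function F -> row_law n (word_sum^~ F).
Proof.
move=> cF H s v hH tw /andP[sv vn] Hs h0 h1.
have [sn _ _] := tw.
apply: (@word_sum_law (Ordinal (ltnW sn)) (Ordinal sn)) => // c.
exact: (@row_pointwise (Ordinal (ltnW sn)) (Ordinal sn) erefl H (Ordinal vn)).
Qed.

Lemma word_sum_col F : class_function F -> col_law n (word_sum^~ F).
Proof.
move=> cF H i s hH tw si Hi h0 h1.
have [sn _ _] := tw.
have iN : (i < n)%N by lia.
apply: (@word_sum_law (Ordinal (ltnW sn)) (Ordinal sn)) => // c.
exact: (@col_pointwise (Ordinal (ltnW sn)) (Ordinal sn) erefl H (Ordinal iN)).
Qed.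

End Words.

(** * Colorings with equal class sizes, and the rows of a word *)

Section Colorings.
Local Open Scope nat_scope.
Variable n : nat.
Notation word := {ffun 'I_n -> 'I_n}.

Definition color_stab (a : 'I_n -> nat) (w : 'S_n) : bool :=
  [forall i, a (w i) == a i].

Definition fiber (a : 'I_n -> nat) (m : nat) : nat := #|[set i | a i == m]|.

Lemma count_mem_geq (s : seq nat) y :
  count_mem y s + count (leq y.+1) s = count (leq y) s.
Proof. by elim: s => //= x s <-; case: ltngtP; lia. Qed.

Lemma perm_eq_count_geq (s1 s2 : seq nat) : size s1 = size s2 ->
  (forall q, 0 < q -> count (leq q) s1 = count (leq q) s2) -> perm_eq s1 s2.
Proof.
move=> sz eqc; apply/allP => y _ /=; apply/eqP.
have eqc' q : count (leq q) s1 = count (leq q) s2.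
  by case: q => [|q]; [rewrite !(@eq_count _ (leq 0) predT) ?count_predT | apply: eqc].
by apply: (@addIn (count (leq y.+1) s2)); rewrite -{1}eqc' !count_mem_geq eqc'.
Qed.

Lemma card_ord_lt m : m <= n -> #|[set k : 'I_n | k < m]| = m.
Proof.
by move=> mn; rewrite -sum1dep_card -(big_ord_widen n (fun=> 1)) // sum1_card card_ord.
Qed.

Lemma count_codom (T : eqType) (f : 'I_n -> T) (P : pred T) :
  count P (codom f) = #|[set i | P (f i)]|.
Proof.
rewrite codomE count_map -sum1_count big_mkcond big_enum /= -big_mkcond.
exact: sum1dep_card.
Qed.

(** First a permutation [p] of the colors matches fibres of equal size; then [p] after [a] and [b]
    have the same content, so a permutation of the vertices relates them. *)
Lemma coloring_perm (a b : 'I_n -> 'I_n) :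
    perm_eq (codom (fun m : 'I_n => fiber (fun i => a i) m))
            (codom (fun m : 'I_n => fiber (fun i => b i) m)) ->
  exists s : 'S_n, forall i j, (b (s i) == b (s j)) = (a i == a j).
Proof.
pose ta := [tuple fiber (fun i => a i) m | m < n].
pose tb := [tuple fiber (fun i => b i) m | m < n].
rewrite !codomE => pe; have : perm_eq ta tb by exact: pe.
case/tuple_permP => p ep.
have ab (k : 'I_n) : fiber (fun i => a i) k = fiber (fun i => b i) (p k).
  by have := congr1 (fun s => nth 0 s k) ep; rewrite -!tnth_nth !tnth_mktuple.
pose tp := [tuple p (a i) | i < n]; pose tq := [tuple b i | i < n].
have : perm_eq tp tq.
  suff : perm_eq (codom (fun i => p (a i))) (codom b) by rewrite !codomE.
  apply/allP => x _ /=; apply/eqP; rewrite !count_codom.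
  have := ab (p^-1 x)%g; rewrite permKV /fiber => e.
  rewrite -[RHS]/(fiber (fun i => b i) x) in e *; rewrite /fiber.
  apply: etrans e; apply: eq_card => i; rewrite !inE.
  by rewrite -(inj_eq (@perm_inj _ (p^-1)%g)) permK.
case/tuple_permP => q eq; exists q => i j.
have bq (k : 'I_n) : b (q k) = p (a k).
  have := congr1 (fun s => nth (p (a k)) s k) eq.
  by rewrite -!tnth_nth !tnth_mktuple.
by rewrite !bq (inj_eq perm_inj).
Qed.

(** The two stabilizers are conjugate Young subgroups. Counting the fibres of size at least [q] is
    the form in which conjugate partitions can be compared. *)
Lemma color_sum_eq (a b : 'I_n -> nat) (F : 'S_n -> rat) :
    class_function F -> (forall i, a i < n) -> (forall i, b i < n) ->
    (forall q, 0 < q -> #|[set m : 'I_n | q <= fiber a m]|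
                        = #|[set m : 'I_n | q <= fiber b m]|) ->
  (\sum_(w | color_stab a w) F w = \sum_(w | color_stab b w) F w)%R.
Proof.
move=> cF an bn eqc.
pose a' i := Ordinal (an i); pose b' i := Ordinal (bn i).
have [|s hs] := @coloring_perm a' b'.
  apply: perm_eq_count_geq => [|q /eqc]; first by rewrite !size_codom.
  by rewrite !count_codom.
symmetry; apply: (sum_conj (g := s)) => // w.
apply/forallP/forallP => h i.
  by have := h (s i); rewrite conj_permE -[_ == _]/(b' _ == b' _) hs.
by rewrite -(permKV s i) conj_permE -[_ == _]/(b' _ == b' _) hs; apply: h.
Qed.

Implicit Type c : word.

Definition col_count c (x : 'I_n) : nat := #|[set i | c i == x]|.

Lemma height_lt c i : height c i < col_count c (c i).
Proof.
apply: proper_card; apply/properP; split.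
  by apply/subsetP => k; rewrite !inE => /andP[].
by exists i; rewrite !inE ?eqxx // ltnn.
Qed.

Lemma height_lt_n c i : height c i < n.
Proof. by apply: leq_trans (height_lt c i) _; rewrite -[X in _ <= X](card_ord n) max_card. Qed.

Lemma height_inj c i j : height c i = height c j -> c i = c j -> i = j.
Proof.
have key k l : c k = c l -> k < l -> height c k < height c l.
  move=> e kl; apply: proper_card; apply/properP; split.
    by apply/subsetP => u; rewrite !inE e => /andP[uk ->]; rewrite (ltn_trans uk).
  by exists k; rewrite !inE ?e ?kl ?eqxx ?ltnn.
move=> er ec; apply: val_inj => /=; case: (ltngtP i j) => // /key.
  by rewrite er ltnn => /(_ ec).
by rewrite er ltnn => /(_ (esym ec)).
Qed.

Lemma height_surj c (x : 'I_n) m : m < col_count c x ->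
  exists2 i, c i = x & height c i = m.
Proof.
move=> mx; have inj : {in [set i | c i == x] &, injective (height c)}.
  by move=> i j; rewrite !inE => /eqP ci /eqP cj e; apply: height_inj e _; rewrite ci.
have mn : m < n by apply: leq_trans mx _; rewrite -[X in _ <= X](card_ord n) max_card.
pose R (i : 'I_n) := Ordinal (height_lt_n c i).
have injR : {in [set i | c i == x] &, injective R}.
  by move=> i j hi hj [e]; apply: inj.
have : Ordinal mn \in R @: [set i | c i == x].
  suff -> : R @: [set i | c i == x] = [set k : 'I_n | k < col_count c x] by rewrite inE.
  apply/eqP; rewrite eqEcard; apply/andP; split.
    apply/subsetP => k /imsetP[i]; rewrite inE => /eqP ci ->.
    by rewrite inE /= -ci height_lt.
  rewrite (card_in_imset injR) -/(col_count c x).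
  by rewrite card_ord_lt // -[X in _ <= X](card_ord n) max_card.
by case/imsetP => i; rewrite inE => /eqP ci /(congr1 val) /= e; exists i.
Qed.

(** A row meets every sufficiently high column exactly once: row lengths and column lengths are
    conjugate partitions. *)
Lemma fiber_height c m : fiber (height c) m = #|[set x | m < col_count c x]|.
Proof.
rewrite /fiber -(card_in_imset (f := c)); last first.
  by move=> i j; rewrite !inE => /eqP hi /eqP hj; apply: height_inj; rewrite hi.
apply: eq_card => x; rewrite inE; apply/imsetP/idP => [[i + ->]|].
  by rewrite inE => /eqP <-; apply: height_lt.
by case/height_surj => i <- hi; exists i; rewrite // inE hi.
Qed.

Lemma down_closed_mem (A : {set 'I_n}) :
    (forall i j : 'I_n, i <= j -> j \in A -> i \in A) ->
  forall i : 'I_n, (i \in A) = (i < #|A|).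
Proof.
move=> dc i; apply/idP/idP => [iA|].
  rewrite -{1}(card_ord_lt (ltn_ord i)); apply: subset_leq_card.
  by apply/subsetP => k; rewrite inE ltnS => ki; apply: dc iA.
apply: contraTT => iA; rewrite -leqNgt -(card_ord_lt (ltnW (ltn_ord i))).
apply: subset_leq_card; apply/subsetP => k kA; rewrite inE ltnNge.
by apply: contra iA => ik; apply: dc kA.
Qed.

(** The factors (m-k)/(m-k-1) telescope, and the one at [k = m - 1] is 1. *)
Lemma prod_phi m : (\prod_(k < m) phi m k = (maxn 1 m)%:R :> rat)%R.
Proof.
elim: m => [|m IH]; first by rewrite big_ord0.
rewrite big_ord_recl (eq_bigr (fun k : 'I_m => phi m k)); last first.
  by move=> k _; rewrite /= /phi /bump /= add1n eqSS -(natr1 m) -(natr1 k) opprD addrACA subrr addr0.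
rewrite IH /=; case: m {IH} => [|m]; first by rewrite phiS.
have mx k : maxn 1 k.+1 = k.+1 by lia.
rewrite phi_neq // subr0 !mx (_ : m.+2%:R - 1 = m.+1%:R :> rat)%R; last first.
  by rewrite -(natr1 m.+1) addrK.
rewrite divfK //.
by rewrite pnatr_eq0.
Qed.

(** * Agreement of the two sums on disjoint unions of cliques *)

Section CliqueUnion.
Variable H : nat -> nat.
Hypotheses (hH : hess n H) (cl : clique_union n H).

Let mono (i j : 'I_n) : i <= j -> H i <= H j.
Proof. by move=> ij; apply: hH.2. Qed.

Let H_gt (i : 'I_n) : i < H i.
Proof. by have /andP[] := hH.1 _ (ltn_ord i). Qed.

Let H_le (i : 'I_n) : H i <= n.
Proof. by have /andP[] := hH.1 _ (ltn_ord i). Qed.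

Lemma clique_le (i j : 'I_n) : j < H i -> H j <= H i.
Proof.
move=> ji; rewrite -[X in _ <= X](cl (ltn_ord i)); apply: hH.2; have := H_le i; lia.
Qed.

Lemma clique_ltE (i j : 'I_n) : (H i < H j) = (H i <= j).
Proof.
apply/idP/idP => [|h]; last by apply: leq_ltn_trans h (H_gt j).
by apply: contraTT; rewrite -ltnNge -leqNgt => /clique_le.
Qed.

(** The first vertex of the clique of [v], obtained as the number of vertices in earlier cliques. *)
Definition first (v : 'I_n) : nat := #|[set i : 'I_n | H i < H v]|.

Lemma first_ltE (i v : 'I_n) : (i < first v) = (H i < H v).
Proof.
rewrite -down_closed_mem ?inE // => k l kl; rewrite !inE.
by apply: leq_ltn_trans; apply: mono.
Qed.

Lemma first_le v : first v <= v.
Proof. by rewrite leqNgt first_ltE ltnn. Qed.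

Lemma clique_adjE (i v : 'I_n) : adj H i v = (first v <= i < v).
Proof.
rewrite /adj andbC; congr (_ && _).
by rewrite [first v <= _]leqNgt first_ltE clique_ltE -ltnNge.
Qed.

Lemma first_eq (i v : 'I_n) : H i = H v -> first i = first v.
Proof. by rewrite /first => ->. Qed.

Lemma adj_H (i v : 'I_n) : first v <= i -> i <= v -> H i = H v.
Proof.
move=> fi iv; apply/eqP; rewrite eqn_leq mono //=.
by rewrite leqNgt -first_ltE -leqNgt.
Qed.

Definition pos (v : 'I_n) : nat := v - first v.

Lemma pos_lt v : pos v < n.
Proof. by apply: leq_ltn_trans (leq_subr _ _) (ltn_ord v). Qed.

Definition pos_word : word := [ffun v => Ordinal (pos_lt v)].

Lemma pos_wordE v : pos_word v = pos v :> nat.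
Proof. by rewrite ffunE. Qed.

(** In each clique the first vertex must take column 0, and every later one a new column that
    exceeds a column already taken by 1. So the columns are 0, 1, 2, ... in order. *)
Lemma word_wt_clique c : word_wt H c != 0%R -> c = pos_word.
Proof.
move=> nz; have nzv v : col_ok H c v /\ forall i, adj H i v -> c i != c v.
  move: nz; rewrite /word_wt (bigD1 v) //= mulf_eq0 negb_or => /andP[+ _].
  rewrite mulf_eq0 negb_or => /andP[]; rewrite mulf_eq0 negb_or => /andP[].
  case: col_ok => //= _ _ hp; split=> // i ai.
  move: hp; rewrite (bigD1 i) //= mulf_eq0 negb_or => /andP[+ _].
  by apply: contraNneq => ->; rewrite phi_eq.
apply/ffunP => v; apply: val_inj; rewrite /= pos_wordE.
case: v => v; elim/ltn_ind: v => v IH vn; set v' := Ordinal vn.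
have IH' i : adj H i v' -> c i = i - first v' :> nat.
  rewrite clique_adjE => /andP[fi iv].
  have := IH i iv (ltn_ord i); rewrite (_ : Ordinal _ = i); last exact: val_inj.
  by move=> ->; rewrite /pos (first_eq (adj_H fi (ltnW iv))).
have [ok ne] := nzv v'; have fv := first_le v'.
rewrite /pos; have [e|lt] := eqVneq (first v') v'.
  rewrite e subnn; case/orP: ok => [/eqP //|/existsP[i]].
  by rewrite clique_adjE e; lia.
have fn : first v' < n by apply: leq_ltn_trans fv vn.
have c0 : c v' != 0 :> nat.
  have a0 : adj H (Ordinal fn) v' by rewrite clique_adjE leqnn /= ltn_neqAle lt.
  by have := ne _ a0; rewrite -val_eqE /= IH' //= subnn eq_sym.
move: ok; rewrite /col_ok (negPf c0) /= => /existsP[i /andP[ai /eqP ci]].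
rewrite -ci IH' //; move: (ai); rewrite clique_adjE => /andP[fi iv].
have [iv'|] := eqVneq i.+1 v'; first by rewrite /= in iv' *; lia.
move=> ne'; have i1v : i.+1 < v' by rewrite ltn_neqAle ne'.
have a1 : adj H (Ordinal (ltn_trans i1v vn)) v' by rewrite clique_adjE i1v /= ltnW.
have := ne _ a1; rewrite -val_eqE /= IH' //=.
by rewrite -ci IH' // subSn ?eqxx.
Qed.

Lemma col_ok_pos v : col_ok H pos_word v.
Proof.
rewrite /col_ok pos_wordE /pos; have fv := first_le v.
have [->|lt] := eqVneq (first v) v; first by rewrite subnn.
apply/orP; right; have vn : v.-1 < n by have := ltn_ord v; lia.
apply/existsP; exists (Ordinal vn).
have fv1 : first v <= v.-1 by lia.
have vv : v.-1 < v by lia.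
rewrite clique_adjE /= fv1 vv pos_wordE /pos.
by rewrite (first_eq (@adj_H (Ordinal vn) v fv1 (ltnW vv))) /=; apply/eqP; lia.
Qed.

Lemma word_wt_pos : word_wt H pos_word = 1%R.
Proof.
rewrite /word_wt big1 // => v _; rewrite col_ok_pos pos_wordE.
have -> : (\prod_(i | adj H i v) phi (pos v) (pos_word i) = (maxn 1 (pos v))%:R :> rat)%R.
  rewrite (eq_bigl (fun i : 'I_n => leq (first v) i && (i < v))); last first.
    by move=> i; rewrite clique_adjE.
  rewrite (eq_bigr (fun i : 'I_n => phi (pos v) (i - first v))); last first.
    move=> i /andP[fi iv]; rewrite pos_wordE /pos.
    by rewrite (first_eq (adj_H fi (ltnW iv))).
  rewrite -(big_ord_widen_cond n (leq (first v)) (fun i => phi (pos v) (i - first v))); last exact: ltnW.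
  transitivity (\prod_(first v <= i < v) phi (pos v) (i - first v))%R.
    by rewrite big_geq_mkord.
  rewrite -{1}(add0n (first v)) big_addn -/(pos v).
  rewrite -prod_phi big_mkord; apply: eq_bigr => i _.
  by rewrite addnK.
by rewrite mul1r mulVf // pnatr_eq0; lia.
Qed.

Lemma word_sum_clique F : word_sum H F = row_sum pos_word F.
Proof.
rewrite /word_sum (bigD1 pos_word) //= word_wt_pos mul1r big1 ?addr0 // => c ne.
have [->|/word_wt_clique e] := eqVneq (word_wt H c) 0%R; first by rewrite mul0r.
by rewrite e eqxx in ne.
Qed.

(** From [w i < H i] follows [H (w i) <= H i]; both sides have the same sum over [i], so equality
    holds throughout. The last vertex [(H j).-1] names the clique because colors must be below
    [n]. *)
Lemma hess_perm_clique w : hess_perm H w = color_stab (fun j : 'I_n => (H j).-1) w.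
Proof.
apply/forallP/forallP => h j; last first.
  have := h j; have := H_gt j; have := H_gt (w j) => h1 h2 /eqP; lia.
have le i : true -> H (w i) <= H i ?= iff (H (w i) == H i).
  by move=> _; split=> //; apply: clique_le; apply: h.
have := (leqif_sum le).2.
rewrite [X in _ == X](reindex_inj (@perm_inj _ w)) /= eqxx => /esym/forallP/(_ j) /eqP ->.
by [].
Qed.

Lemma col_count_pos (x y : 'I_n) : x <= y ->
  col_count pos_word y <= col_count pos_word x.
Proof.
move=> xy; have lt (i : 'I_n) : i - (y - x) < n by apply: leq_ltn_trans (leq_subr _ _) (ltn_ord i).
rewrite /col_count -(card_in_imset (f := fun i => Ordinal (lt i))).
  apply: subset_leq_card; apply/subsetP => k /imsetP[i]; rewrite !inE -!val_eqE /=.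
  rewrite !pos_wordE => /eqP pi ->; rewrite /pos in pi *.
  have fi : first i <= i - (y - x) by have := first_le i; lia.
  by rewrite /= (first_eq (@adj_H (Ordinal (lt i)) i fi (leq_subr _ _))) /=; lia.
move=> i j; rewrite !inE -!val_eqE /= !pos_wordE => /eqP pi /eqP pj [e].
by apply: val_inj => /=; rewrite /pos in pi pj; lia.
Qed.

(** A clique with more than [q] vertices has exactly one vertex in position [q]. *)
Lemma fiber_clique_le (q : 'I_n) :
  #|[set m : 'I_n | q < fiber (fun j : 'I_n => (H j).-1) m]| = col_count pos_word q.
Proof.
have Hn (j : 'I_n) : (H j).-1 < n by have := H_gt j; have := H_le j; lia.
rewrite /col_count -[RHS](card_in_imset (f := fun j => Ordinal (Hn j))); last first.
  have key i j : pos_word i = q -> pos_word j = q -> H i = H j -> i < j -> False.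
    move=> /(congr1 val) /= + /(congr1 val) /=; rewrite !pos_wordE /pos => pi pj e ij.
    have := first_eq e; have := first_le i; have := first_le j; lia.
  move=> i j; rewrite !inE => /eqP pi /eqP pj [e].
  have eH : H i = H j by have := H_gt i; have := H_gt j; lia.
  by apply: val_inj => /=; case: (ltngtP i j) => // /key h; [case: (h pi pj eH) | case: (h pj pi (esym eH))].
apply: eq_card => m; rewrite inE; apply/idP/imsetP => [qm|[j]]; last first.
  rewrite inE -val_eqE /= pos_wordE => /eqP pj ->; rewrite -pj /pos /=.
  pose B := [set i : 'I_n | (H i).-1 == (H j).-1]; have : #|[set k : 'I_n | k < j.+1]| <= #|[set k : 'I_n | k < first j]| + #|B|.
    apply: leq_trans (leq_card_setU _ _); apply: subset_leq_card.
    apply/subsetP => k; rewrite !inE ltnS => kj; rewrite orbC.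
    have [fk|kf] := leqP (first j) k; last by rewrite orbT.
    by rewrite (adj_H fk kj) eqxx.
  have fj := first_le j.
  rewrite (card_ord_lt (ltn_ord j)) (card_ord_lt (leq_trans fj (ltnW (ltn_ord j)))) => h.
  by rewrite -[fiber _ _]/#|B|; lia.
have /card_gt0P[i0] : 0 < #|[set i : 'I_n | (H i).-1 == m]| by apply: leq_ltn_trans qm.
rewrite inE => /eqP Hi0; have gi0 := H_gt i0; have fi0 := first_le i0.
have HB (i : 'I_n) : (H i).-1 = m -> H i = H i0 by have := H_gt i; lia.
have : #|[set k : 'I_n | k < m.+1]| >= #|[set k : 'I_n | k < first i0]| + fiber (fun j : 'I_n => (H j).-1) m.
  rewrite /fiber -cardsUI (_ : _ :&: _ = set0) ?cards0 ?addn0.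
    apply: subset_leq_card; apply/subsetP => k; rewrite !inE => /orP[|/eqP/HB e].
      by lia.
    by have := H_gt k; lia.
  apply/setP => k; rewrite !inE; apply/negP => /andP[+ /eqP/HB e].
  by rewrite first_ltE e ltnn.
rewrite !card_ord_lt //; last by apply: leq_trans fi0 (ltnW (ltn_ord i0)).
move=> cm; have jn : first i0 + q < n by have := ltn_ord m; lia.
exists (Ordinal jn).
  rewrite inE -val_eqE /= pos_wordE /pos; set j := Ordinal jn.
  suff -> : first j = first i0 by rewrite /= addKn.
  apply: first_eq; apply/eqP; rewrite eqn_leq clique_le /=; last by lia.
  by rewrite -[X in _ <= X]/(H j) leqNgt -first_ltE -leqNgt /= leq_addr.
apply: val_inj => /=; set j := Ordinal jn; suff -> : H (first i0 + q) = H i0 by [].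
apply/eqP; rewrite eqn_leq (clique_le (j := j)) /=; last by lia.
by rewrite -[X in _ <= X]/(H j) leqNgt -first_ltE -leqNgt /= leq_addr.
Qed.

(** Both sides are sums over one Young subgroup, with the cliques or the rows of [pos_word] as
    blocks. Its columns collect the vertices of equal position, so by conjugation its rows have the
    sizes of the cliques. *)
Theorem clique_base (F : 'S_n -> rat) : class_function F -> hess_sum H F = word_sum H F.
Proof.
move=> cF; rewrite word_sum_clique /hess_sum (eq_bigl _ _ hess_perm_clique).
apply: (color_sum_eq cF) => [j|j|q q0].
- by have := H_gt j; have := H_le j; lia.
- exact: height_lt_n.
have [qn|nq] := ltnP q.-1 n; last first.
  have z a : #|[set m : 'I_n | q <= fiber a m]| = 0.
    apply/eqP; rewrite cards_eq0; apply/eqP/setP => m; rewrite !inE.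
    apply/negbTE; rewrite -ltnNge; apply: leq_ltn_trans (_ : n < q); last by lia.
    by rewrite -[X in _ <= X](card_ord n) max_card.
  by rewrite !z.
have := fiber_clique_le (Ordinal qn); rewrite /= (prednK q0) => ->.
have cn x : col_count pos_word x <= n by rewrite -[X in _ <= X](card_ord n) max_card.
transitivity #|[set k : 'I_n | k < col_count pos_word (Ordinal qn)]|.
  by rewrite card_ord_lt.
apply: eq_card => m; rewrite [in LHS]inE [in RHS]inE fiber_height.
have dc : forall i j : 'I_n, i <= j -> j \in [set x | m < col_count pos_word x] ->
    i \in [set x | m < col_count pos_word x].
  by move=> i j ij; rewrite !inE => h; apply: leq_trans h (col_count_pos ij).
have := down_closed_mem dc (Ordinal qn).
by rewrite inE /= (prednK q0).
Qed.

End CliqueUnion.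
End Colorings.

(** * Equality of the two sums, and integrality of the coefficients *)

Section Integrality.
Local Open Scope ring_scope.
Variable n : nat.
Notation word := {ffun 'I_n -> 'I_n}.
Implicit Types (c d f : word) (w : 'S_n) (H : nat -> nat).

Theorem hess_word_sum H (F : 'S_n -> rat) :
  hess n H -> class_function F -> hess_sum H F = word_sum H F.
Proof.
move=> hH cF; apply/eqP; rewrite -subr_eq0; apply/eqP.
apply: (@hess_unique n (fun H => hess_sum H F - word_sum H F)) => //.
- by move=> K K' e; rewrite (hess_sum_ext F e) (word_sum_ext F e).
- move=> K s v h1 h2 h3 h4 h5 h6.
  have := hess_sum_row cF h1 h2 h3 h4 h5 h6; have := word_sum_row cF h1 h2 h3 h4 h5 h6.
  by move: (hess_sum _ _) (hess_sum _ _) (hess_sum _ _) (word_sum _ _) (word_sum _ _) (word_sum _ _) => *; lra.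
- move=> K s v h1 h2 h3 h4 h5 h6.
  have := hess_sum_col cF h1 h2 h3 h4 h5 h6; have := word_sum_col cF h1 h2 h3 h4 h5 h6.
  by move: (hess_sum _ _) (hess_sum _ _) (hess_sum _ _) (word_sum _ _) (word_sum _ _) (word_sum _ _) => *; lra.
- by move=> K hK cK; rewrite clique_base ?subrr.
Qed.

Definition same_shape c d : bool :=
  [forall m : 'I_n, fiber (height c) m == fiber (height d) m].

Lemma same_refl : reflexive same_shape.
Proof. by move=> c; apply/forallP. Qed.

Lemma same_sym : symmetric same_shape.
Proof. by move=> c d; apply/forallP/forallP => h m; rewrite eq_sym. Qed.

Lemma same_trans : transitive same_shape.
Proof.
by move=> c d e /forallP h1 /forallP h2; apply/forallP => m; rewrite (eqP (h1 m)).
Qed.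

Lemma same_row_sum c d (F : 'S_n -> rat) :
  class_function F -> same_shape c d -> row_sum c F = row_sum d F.
Proof.
move=> cF /forallP cd; apply: (color_sum_eq cF) => [i|i|q _]; try exact: height_lt_n.
by apply: eq_card => m; rewrite !inE (eqP (cd m)).
Qed.

(** [pick] depends only on the set of words of this shape, so all of them get the same
    representative. *)
Definition shape_rep c : word := odflt c [pick d | same_shape c d].

Lemma shape_repP c : same_shape c (shape_rep c).
Proof. by rewrite /shape_rep; case: pickP => [d //|/(_ c)]; rewrite same_refl. Qed.

Lemma shape_rep_eq c d : (shape_rep c == shape_rep d) = same_shape c d.
Proof.
apply/eqP/idP => [e|cd].
  by apply: same_trans (shape_repP c) _; rewrite e same_sym shape_repP.
rewrite /shape_rep (eq_pick (Q := same_shape d)) => [|e]; last first.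
  apply/idP/idP; last exact: same_trans.
  by apply: same_trans; rewrite same_sym.
by case: pickP => // /(_ d); rewrite same_refl.
Qed.

Definition shape_wt H c : rat := \sum_(d | same_shape c d) word_wt H d.

Lemma word_sum_shape H (F : 'S_n -> rat) : class_function F ->
  word_sum H F = \sum_(c | shape_rep c == c) shape_wt H c * row_sum c F.
Proof.
move=> cF; rewrite /word_sum (partition_big shape_rep (fun c => shape_rep c == c)) /=.
  apply: eq_bigr => c /eqP rc; rewrite /shape_wt mulr_suml.
  have eqP' d : (shape_rep d == c) = same_shape c d.
    by rewrite -rc shape_rep_eq rc same_sym.
  rewrite (eq_bigl _ _ eqP'); apply: eq_bigr => d cd.
  by rewrite (same_row_sum cF cd).
by move=> c _; rewrite shape_rep_eq same_sym shape_repP.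
Qed.

Definition same_type f d : bool := [forall x, col_count f x == col_count d x].

(** The rows of [c] and the fibres of [f] meet in at most one vertex. *)
Definition joint_inj c f : bool :=
  [forall i, forall j, (height c i == height c j) && (f i == f j) ==> (i == j)].

Lemma joint_injP c f : reflect
  (forall i j, height c i = height c j -> f i = f j -> i = j) (joint_inj c f).
Proof.
apply: (iffP forallP) => [h i j hi fi|h i].
  by have /forallP/(_ j) := h i; rewrite hi fi !eqxx => /eqP.
by apply/forallP => j; apply/implyP => /andP[/eqP hi /eqP fi]; rewrite (h i j).
Qed.

(* Up to sign, the values of the character induced from the sign character of
   the Young subgroup of type d. *)
Definition sign_count d w : rat :=
  (-1) ^+ w * #|[set f | same_type f d && (wcomp f w == f)]|%:R.

Lemma col_count_comp f (g : 'S_n) x : col_count (wcomp f g) x = col_count f x.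
Proof.
rewrite /col_count -(card_imset _ (@perm_inj _ g)); apply: eq_card => i.
rewrite inE; apply/imsetP/idP => [[k + ->]|fi]; first by rewrite inE wcompE.
by exists (g^-1 i)%g; rewrite ?inE ?wcompE permKV.
Qed.

Lemma wcompM f (g h : 'S_n) : wcomp (wcomp f g) h = wcomp f (h * g)%g.
Proof. by apply/ffunP => i; rewrite !wcompE permM. Qed.

Lemma wcomp1 f : wcomp f 1%g = f.
Proof. by apply/ffunP => i; rewrite wcompE perm1. Qed.

Lemma wcomp_inj (g : 'S_n) : injective (fun f : word => wcomp f g).
Proof.
by move=> f d /(congr1 (fun e : word => wcomp e (g^-1)%g)); rewrite !wcompM mulVg !wcomp1.
Qed.

Lemma sign_count_class d : class_function (sign_count d).
Proof.
move=> w g; rewrite /sign_count odd_permJ; congr (_ * _%:R).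
rewrite -[RHS](card_imset _ (@wcomp_inj (g^-1)%g)); apply: eq_card => f.
rewrite inE; apply/andP/imsetP => [[tf /eqP fw]|[e + ->]].
  exists (wcomp f g); last by rewrite wcompM mulVg wcomp1.
  rewrite inE; apply/andP; split.
    by apply/forallP => x; rewrite col_count_comp; apply: (forallP tf).
  by rewrite wcompM -{2}fw wcompM conjgE !mulgA mulgV mul1g.
rewrite inE => /andP[te /eqP ew]; split.
  by apply/forallP => x; rewrite col_count_comp; apply: (forallP te).
by rewrite wcompM conjgE -!mulgA mulgV mulg1 -wcompM ew.
Qed.

(** For fixed [f], two vertices in the same row and the same fibre give a transposition that
    reverses signs and cancels everything. If there are none, only the identity preserves the rows
    and [f]. *)
Lemma row_sum_sign c d : row_sum c (sign_count d) =
  #|[set f | same_type f d && joint_inj c f]|%:R.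
Proof.
rewrite /row_sum /sign_count.
under eq_bigr => w _.
  rewrite -sum1dep_card natr_sum mulr_sumr.
  over.
rewrite (exchange_big_dep (fun f => same_type f d)) /=; last by move=> w f _ /andP[].
rewrite -sum1dep_card natr_sum big_mkcondr /=; apply: eq_bigr => f tf.
case: ifP => [/joint_injP inj|/negbT ninj].
  rewrite (bigD1 1%g) /=; last first.
    by rewrite tf wcomp1 eqxx !andbT; apply/forallP => i; rewrite perm1.
  rewrite odd_perm1 big1 ?addr0 ?mulr1 // => w /andP[/andP[/forallP wc /andP[_ /eqP fw]] w1].
  case/eqP: w1; apply/permP => i; rewrite perm1; apply: inj; first exact/eqP.
  by rewrite -{2}fw wcompE.
have [i [j [hij fij nij]]] : exists i, exists j, [/\ height c i = height c j, f i = f j & i != j].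
  move: ninj; rewrite negb_forall => /existsP[i]; rewrite negb_forall => /existsP[j].
  by rewrite negb_imply => /andP[/andP[/eqP h1 /eqP h2] h3]; exists i, j.
set S := \sum_(w | _) _; suff : S + S = 0 by move=> h; lra.
have hg k : height c (tperm i j k) = height c k by case: tpermP => // ->.
have fg k : f (tperm i j k) = f k by case: tpermP => // ->.
rewrite {2}/S (reindex_inj (mulgI (tperm i j))) /= /S.
rewrite [X in _ + X](_ : _ = - S) ?subrr // /S -sumrN; apply: eq_big => w.
  congr (_ && (_ && _)).
    apply/forallP/forallP => h k.
      by have := h (tperm i j k); rewrite permM tpermK hg.
    by rewrite permM -(hg k); apply: h.
  apply/eqP/eqP => /ffunP h; apply/ffunP => k; have := h (tperm i j k).
    by rewrite !wcompE permM tpermK fg.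
  by rewrite !wcompE permM fg.
by move=> _; rewrite odd_mul_tperm nij addTb signrN !mulr1.
Qed.

(** Distinct naturals have at least the sum 0 + 1 + ..., with equality only for an initial segment.
    The induction removes an element of largest value, which is at least [#|A| - 1]. *)
Lemma sum_inj_ge (A : {set 'I_n}) (g : 'I_n -> nat) : {in A &, injective g} ->
  (\sum_(m < #|A|) m <= \sum_(i in A) g i)%N /\
  ((\sum_(i in A) g i <= \sum_(m < #|A|) m)%N -> {in A, forall i, g i < #|A|}%N).
Proof.
move: {2}#|A| (erefl #|A|) => k; elim: k A => [|k IH] A Ak inj.
  by move/eqP: (Ak); rewrite cards_eq0 => /eqP->; split=> [|_ i]; rewrite ?cards0 ?big_ord0 ?inE.
have [j jA] : exists j, j \in A by apply/card_gt0P; rewrite Ak.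
case: (arg_maxnP (P := fun i => i \in A) g jA) => i0 i0A imax.
have Ak' : #|A :\ i0| = k by have := cardsD1 i0 A; rewrite i0A Ak; lia.
have inj' : {in A :\ i0 &, injective g}.
  by move=> x y; rewrite !inE => /andP[_ xA] /andP[_ yA]; apply: inj.
have [IH1 IH2] := IH _ Ak' inj'; rewrite Ak' in IH1 IH2.
have gk : (k <= g i0)%N.
  pose G i : 'I_(g i0).+1 := inord (g i).
  have injG : {in A &, injective G}.
    move=> x y xA yA /(congr1 val); rewrite /= !inordK ?ltnS; try exact: imax.
    exact: inj.
  have := max_card (mem (G @: A)); rewrite card_ord (card_in_imset injG) Ak; lia.
rewrite Ak big_ord_recr /= (big_setD1 i0) //=.
split=> [|le]; first by rewrite addnC leq_add.
have gi0 : g i0 = k.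
  apply/eqP; rewrite eqn_leq gk andbT -(leq_add2r (\sum_(i in A :\ i0) g i)).
  by apply: leq_trans le _; rewrite addnC leq_add2l.
by move=> i iA; rewrite ltnS -gi0; apply: imax.
Qed.

(** The sum of the binomials C(l, 2) over the column lengths l, used in place of the dominance
    order. *)
Definition energy d : nat := (\sum_x \sum_(m < col_count d x) m)%N.

Lemma sum_height c : (\sum_i height c i = energy c)%N.
Proof.
rewrite (partition_big c xpredT) //=; apply: eq_bigr => x _.
pose A := [set i | c i == x]; pose R (i : 'I_n) := Ordinal (height_lt_n c i).
have inj : {in A &, injective R}.
  move=> i j; rewrite !inE => /eqP ci /eqP cj [e].
  by apply: height_inj e _; rewrite ci.
have kn : (col_count c x <= n)%N by rewrite -[X in (_ <= X)%N](card_ord n) max_card.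
have RA : R @: A = [set k : 'I_n | (k < col_count c x)%N].
  apply/setP => k; rewrite inE; apply/imsetP/idP => [[i + ->]|].
    by rewrite inE => /eqP <-; apply: height_lt.
  case/height_surj => i ci hi; exists i; first by rewrite inE ci.
  exact: val_inj.
rewrite (big_ord_widen n id kn) -[RHS](eq_bigl _ _ (fun k => in_set (fun k : 'I_n => (k < col_count c x)%N) k)).
rewrite -RA (big_imset _ inj) /=.
by apply: eq_bigl => i; rewrite inE.
Qed.

Lemma joint_energy c f : joint_inj c f ->
  (energy f <= energy c)%N /\
  ((energy c <= energy f)%N -> forall i, height c i < col_count f (f i))%N.
Proof.
move=> /joint_injP inj; rewrite -(sum_height c) (partition_big f xpredT) //=.
have injx x : {in [set i | f i == x] &, injective (height c)}.
  by move=> i j; rewrite !inE => /eqP fi /eqP fj e; apply: inj e _; rewrite fi.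
have key x : (\sum_(m < col_count f x) m <= \sum_(i | f i == x) height c i)%N /\
    ((\sum_(i | f i == x) height c i <= \sum_(m < col_count f x) m)%N ->
     {in [set i | f i == x], forall i, height c i < col_count f x}%N).
  have := sum_inj_ge (injx x).
  by rewrite (eq_bigl (fun i => f i == x)) => [|i]; last by rewrite inE.
split=> [|le i]; first by apply: leq_sum => x _; case: (key x).
apply: (key (f i)).2; last by rewrite inE.
have le' x : true -> (\sum_(m < col_count f x) m <= \sum_(i | f i == x) height c i
     ?= iff (\sum_(m < col_count f x) m == \sum_(i | f i == x) height c i))%N.
  by move=> _; split=> //; case: (key x).
have [le1 eq1] := leqif_sum le'.
have : (\sum_i0 \sum_(m < col_count f i0) m == \sum_i0 \sum_(i1 | f i1 == i0) height c i1)%N.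
  by rewrite eqn_leq le1.
by rewrite eq1 => /forallP/(_ (f i)) /eqP <-.
Qed.

Lemma sum_fiber (a : 'I_n -> nat) : (forall i, a i < n)%N -> (\sum_(m < n) fiber a m = n)%N.
Proof.
move=> an; rewrite -[RHS]card_ord -sum1_card.
rewrite [RHS](partition_big (fun i => Ordinal (an i)) xpredT) //=.
apply: eq_bigr => m _; rewrite /fiber -sum1dep_card.
by apply: eq_bigl => i; rewrite -val_eqE.
Qed.

Lemma same_type_energy f d : same_type f d -> energy f = energy d.
Proof.
by move=> /forallP h; apply: eq_bigr => x _; rewrite (eqP (h x)).
Qed.

(** By extremality [f] injects row [m] of [c] into the columns of [d] longer than [m], whose number
    is the length of row [m] of [d]. Both totals over [m] are [n]. *)
Lemma joint_same c d f : same_type f d -> joint_inj c f ->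
  (energy c <= energy d)%N -> same_shape c d.
Proof.
move=> fd inj; rewrite -(same_type_energy fd) => /((joint_energy inj).2) hlt.
move/forallP: fd => fd; move/joint_injP: inj => inj.
have le m : true -> (fiber (height c) m <= fiber (height d) m
    ?= iff (fiber (height c) m == fiber (height d) m))%N.
  move=> _; split=> //; rewrite [X in (_ <= X)%N]fiber_height.
  rewrite /fiber -(card_in_imset (f := f)); last first.
    by move=> i j; rewrite !inE => /eqP hi /eqP hj; apply: inj; rewrite hi.
  apply: subset_leq_card; apply/subsetP => x /imsetP[i + ->]; rewrite !inE => /eqP <-.
  by rewrite -(eqP (fd (f i))).
have [_] := leqif_sum (fun m : 'I_n => le m).
rewrite !sum_fiber ?eqxx; try exact: height_lt_n.
by move=> /esym/forallP h; apply/forallP => m; apply: h.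
Qed.

(** The diagonal entry of the triangular pairing: in the extremal case [f] is [c] composed with a
    unique permutation preserving the rows. *)
Lemma stab_count c :
  #|[set f | same_type f c && joint_inj c f]| = #|[set w | row_stab c w]|.
Proof.
rewrite -[RHS](card_in_imset (f := wcomp c)).
  apply: eq_card => f; rewrite inE; apply/andP/imsetP => [[fc inj]|[w + ->]].
    have := (joint_energy inj).2; rewrite (same_type_energy fc) leqnn => /(_ erefl) hlt.
    have /fin_all_exists[h hh] i : exists k, c k = f i /\ height c k = height c i.
      have := hlt i; rewrite (eqP (forallP fc _)) => /height_surj[k ck hk].
      by exists k.
    have hinj : injective h.
      move=> i j e; have [c1 h1] := hh i; have [c2 h2] := hh j.
      by move/joint_injP: inj; apply; [rewrite -h1 -h2 e | rewrite -c1 -c2 e].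
    exists (perm hinj); last by apply/ffunP => i; rewrite wcompE permE; case: (hh i).
    by rewrite inE; apply/forallP => i; rewrite permE; case: (hh i) => _ ->.
  rewrite inE => /forallP wc; split; first by apply/forallP => x; rewrite col_count_comp.
  apply/joint_injP => i j; rewrite -(eqP (wc i)) -(eqP (wc j)) !wcompE => h1 h2.
  by apply: (@perm_inj _ w); apply: height_inj h1 h2.
move=> w v; rewrite !inE => /forallP wc /forallP vc /ffunP e; apply/permP => i.
apply: (@height_inj _ c); last by have := e i; rewrite !wcompE.
by rewrite (eqP (wc i)) (eqP (vc i)).
Qed.

Definition word_act f w : word := wcomp f (w^-1)%g.

Lemma word_act1 : word_act^~ 1%g =1 id.
Proof. by move=> f; rewrite /word_act invg1 wcomp1. Qed.

Lemma word_actM f : act_morph word_act f.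
Proof. by move=> g h; rewrite /word_act wcompM invMg. Qed.

Canonical word_action := TotalAction word_act1 word_actM.

Lemma row_stab_group c : group_set [set w | row_stab c w].
Proof.
apply/group_setP; split=> [|g h]; first by rewrite inE; apply/forallP => i; rewrite perm1.
rewrite !inE => /forallP hg /forallP hh; apply/forallP => i.
by rewrite permM (eqP (hh _)).
Qed.

Canonical row_group c := Group (row_stab_group c).

(** The row stabilizer acts freely on these words, since a vertex is determined by its row and its
    value under [f]. *)
Lemma stab_dvd c d : (#|[set w | row_stab c w]|
  %| #|[set f | same_type f d && joint_inj c f]|)%N.
Proof.
set G := [set w | _]; set S := [set f | _].
have aG : [acts G, on S | word_action].
  apply/subsetP => w wG; rewrite inE; apply/andP; split; first by rewrite inE.
  rewrite inE; apply/subsetP => f; rewrite !inE => /andP[/forallP fd /joint_injP inj].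
  have := groupVr (G := row_group c) wG; rewrite inE => /forallP wc.
  apply/andP; split; first by apply/forallP => x; rewrite /= /word_act col_count_comp.
  apply/joint_injP => i j; rewrite /= /word_act !wcompE -(eqP (wc i)) -(eqP (wc j)) => h1 h2.
  by apply: (@perm_inj _ (w^-1)%g); apply: inj h1 h2.
rewrite -(acts_sum_card_orbit aG); apply: dvdn_sum => T /imsetP[f + ->].
rewrite inE => /andP[_ /joint_injP inj].
rewrite /orbit card_in_imset //= => w v wG vG /ffunP e.
have := groupVr (G := row_group c) wG; have := groupVr (G := row_group c) vG.
rewrite !inE => /forallP vc /forallP wc; apply: invg_inj; apply/permP => i.
apply: inj; first by rewrite (eqP (wc i)) (eqP (vc i)).
by have := e i; rewrite /= /word_act !wcompE.
Qed.

Lemma energy_le c : (energy c <= n * n)%N.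
Proof.
rewrite -sum_height -[X in (_ <= X * _)%N]card_ord -sum_nat_const.
by apply: leq_sum => i _; apply: ltnW (height_lt_n c i).
Qed.

(** Pairing with [sign_count c] gives an integer. The other shapes that contribute have larger
    energy and give integers by induction, so the diagonal term is one too. *)
Lemma shape_wt_int H c : hess n H -> shape_rep c == c ->
  shape_wt H c * #|[set w | row_stab c w]|%:R \is a Num.int.
Proof.
move=> hH; have [k] := ubnP (n * n - energy c)%N.
elim: k c => // k IH c; rewrite ltnS => ck /eqP rc.
have := hess_word_sum hH (sign_count_class c).
rewrite (word_sum_shape H (sign_count_class c)) (bigD1 c) ?rc //=.
rewrite row_sum_sign stab_count => /eqP; rewrite -subr_eq => /eqP <-.
apply: rpredB.
  apply: rpred_sum => w _; rewrite /sign_count.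
  by apply: rpredM; [apply: rpredX; rewrite rpredN1 | apply: rpred_nat].
apply: rpred_sum => d /andP[rd dc]; rewrite row_sum_sign.
have [->|] := posnP #|[set f | same_type f c && joint_inj d f]|.
  by rewrite mulr0 rpred0.
case/card_gt0P => f; rewrite inE => /andP[fc inj].
have [q ->] := dvdnP (stab_dvd d c).
rewrite mulnC natrM mulrA; apply: rpredM; last exact: rpred_nat.
apply: IH => //; have [le1 _] := joint_energy inj; rewrite (same_type_energy fc) in le1.
have lt : (energy c < energy d)%N.
  rewrite ltn_neqAle le1 andbT; apply: contra dc => /eqP e.
  have := joint_same fc inj; rewrite e leqnn => /(_ erefl).
  by rewrite -shape_rep_eq (eqP rd) rc.
have := energy_le d; lia.
Qed.

Theorem young_expansion H : hess n H ->
  exists Z : word -> nat, forall F, class_function F ->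
    hess_sum H F = \sum_c (Z c)%:R / #|[set w | row_stab c w]|%:R * row_sum c F.
Proof.
move=> hH.
have exZ c : exists z : nat, (shape_rep c == c)%:R * shape_wt H c = z%:R / #|[set w | row_stab c w]|%:R.
  have nz : #|[set w | row_stab c w]|%:R != 0 :> rat.
    by rewrite pnatr_eq0 -lt0n (cardG_gt0 (row_group c)).
  have [rc|_] := boolP (shape_rep c == c); last by exists 0%N; rewrite !mul0r.
  have : shape_wt H c * #|[set w | row_stab c w]|%:R \is a Num.nat.
    rewrite natrEint shape_wt_int //=; apply: mulr_ge0; last exact: ler0n.
    by apply: sumr_ge0 => d _; apply: word_wt_ge0.
  by case/natrP => z e; exists z; rewrite mul1r -e mulfK.
have /fin_all_exists[Z hZ] := exZ.
exists Z => F cF; rewrite hess_word_sum // word_sum_shape // big_mkcond.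
apply: eq_bigr => c _; rewrite -hZ.
by case: ifP => _; rewrite ?mul1r ?mul0r.
Qed.

End Integrality.

(** * Weakly increasing words with given content *)

Section MonotoneWords.
Local Open Scope nat_scope.
Variable n : nat.

Let le (x y : 'I_n) := x <= y.

Let le_trans : transitive le. Proof. by move=> y x z; apply: leq_trans. Qed.
Let le_total : total le. Proof. by move=> x y; apply: leq_total. Qed.
Let le_anti : antisymmetric le.
Proof. by move=> x y /anti_leq /val_inj. Qed.

Lemma sorted_enum_ord p : sorted (fun i j : 'I_p => i < j) (enum 'I_p).
Proof.
have := iota_ltn_sorted 0 p; rewrite -val_enum_ord sorted_map.
by apply: sub_sorted.
Qed.

Lemma mono_sorted p (u : 'I_p -> 'I_n) :
  (forall i j : 'I_p, i < j -> u i <= u j) -> sorted le (codom u).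
Proof.
move=> mu; rewrite codomE.
by apply: (homo_sorted (e := fun i j : 'I_p => i < j)) (sorted_enum_ord p).
Qed.

Lemma mono_unique p (u v : 'I_p -> 'I_n) :
    (forall i j : 'I_p, i < j -> u i <= u j) ->
    (forall i j : 'I_p, i < j -> v i <= v j) ->
    (forall x, #|[set i | u i == x]| = #|[set i | v i == x]|) ->
  u =1 v.
Proof.
move=> mu mv euv i; have : codom u = codom v.
  apply: (sorted_eq le_trans le_anti); try exact: mono_sorted.
  by apply/allP => x _ /=; rewrite !count_codom euv.
rewrite !codomE => /eq_in_map; apply; exact: mem_enum.
Qed.

Lemma mono_exists p (m : 'I_n -> nat) : \sum_x m x = p ->
  exists2 u : 'I_p -> 'I_n, (forall i j : 'I_p, i < j -> u i <= u j)
    & forall x, #|[set i | u i == x]| = m x.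
Proof.
move=> sm; pose L := sort le (flatten [seq nseq (m x) x | x <- enum 'I_n]).
have szL : size L == p.
  rewrite size_sort size_flatten /shape -map_comp sumnE big_map big_enum /=.
  by rewrite -[p in _ == p]sm; apply/eqP; apply: eq_bigr => x _; rewrite /= size_nseq.
exists (tnth (Tuple szL)) => [i j ij|x].
  have x0 := tnth (Tuple szL) i; rewrite !(tnth_nth x0) /=.
  have := sort_sorted le_total (flatten [seq nseq (m x) x | x <- enum 'I_n]).
  move/(sorted_ltn_nth le_trans x0); rewrite -/L (eqP szL).
  by apply; rewrite ?inE ?ltn_ord.
rewrite -(count_codom (tnth (Tuple szL)) (pred1 x)) codomE map_tnth_enum /= count_sort count_flatten -map_comp.
rewrite sumnE big_map big_enum (bigD1 x) //= count_nseq /= eqxx mul1n big1 ?addn0 // => y yx.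
by rewrite count_nseq /= (negPf yx).
Qed.

End MonotoneWords.

(** * Kostka numbers of hooks *)

Section HookKostka.
Local Open Scope nat_scope.
Variables (n N k : nat).
Hypothesis kN : k < N.
Let p := N - k.
Let theta := p :: nseq k 1.
Notation tableau := {ffun box theta -> 'I_n}.

Let p_gt0 : 0 < p. Proof. by rewrite subn_gt0. Qed.
Let sz : size theta = k.+1. Proof. by rewrite /= size_nseq. Qed.

Let box_arm_proof (j : 'I_p) : (ord0 : 'I_(size theta), j : 'I_(head 0 theta)).2 < nth 0 theta (ord0 : 'I_(size theta), j : 'I_(head 0 theta)).1.
Proof. exact: ltn_ord. Qed.

(** The arm is the whole first row, corner included, so it has [p = N - k] boxes; the leg has the
    other [k]. *)
Definition arm (j : 'I_p) : box theta := exist _ (ord0, j) (box_arm_proof j).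

Definition corner : 'I_p := Ordinal p_gt0.

Let leg_lt (r : 'I_k) : r.+1 < size theta.
Proof. by rewrite sz ltnS. Qed.

Let box_leg_proof (r : 'I_k) : (Ordinal (leg_lt r), corner : 'I_(head 0 theta)).2 < nth 0 theta (Ordinal (leg_lt r), corner : 'I_(head 0 theta)).1.
Proof. by rewrite /= nth_nseq ltn_ord. Qed.

Definition leg (r : 'I_k) : box theta := exist _ (Ordinal (leg_lt r), corner) (box_leg_proof r).

Lemma hook_box (b : box theta) : (exists j, b = arm j) \/ (exists r, b = leg r).
Proof.
case: b => -[[[|r] hr] j] hb.
  left; exists j; apply: val_inj; rewrite /=; congr (_, _); exact: val_inj.
right; have rk : r < k by rewrite -ltnS -sz.
exists (Ordinal rk); apply: val_inj; rewrite /=; congr (_, _); apply: val_inj => //=.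
by move: hb; rewrite /= nth_nseq rk; case: (nat_of_ord j).
Qed.

Lemma arm_inj : injective arm.
Proof. by move=> i j []. Qed.

Lemma leg_inj : injective leg.
Proof. by move=> i j [e]; apply: val_inj. Qed.

Lemma arm_leg j r : arm j <> leg r.
Proof. by []. Qed.

Lemma hook_semistandardP (t : tableau) : reflect
  [/\ forall i j : 'I_p, i < j -> t (arm i) <= t (arm j),
      forall r s : 'I_k, r < s -> t (leg r) < t (leg s)
    & forall r, t (arm corner) < t (leg r)] (semistandard t).
Proof.
apply: (iffP forallP) => [h|[h1 h2 h3] b].
  have hb b b' := forallP (h b) b'.
  split=> [i j ij|r s rs|r].
  - by have /andP[/implyP + _] := hb (arm i) (arm j); apply; rewrite /box_row /box_col /= ij.
  - by have /andP[_ /implyP] := hb (leg r) (leg s); apply; rewrite /box_row /box_col /= ltnS rs.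
  - by have /andP[_ /implyP] := hb (arm corner) (leg r); apply; rewrite /box_row /box_col /=.
apply/forallP => b'; rewrite /box_row /box_col.
case: (hook_box b) => [[i ->]|[r ->]]; case: (hook_box b') => [[j ->]|[s ->]] /=.
- by rewrite ltnn andbF andbT; apply/implyP => ij; apply: h1.
- rewrite andbT /=; apply/implyP => /eqP i0.
  by rewrite (_ : i = corner) //; apply: val_inj.
- by rewrite andbF.
- by rewrite andbF /=; apply/implyP => rs; apply: h2.
Qed.

Lemma card_hook_boxes (t : tableau) (x : 'I_n) : #|[set b | t b == x]| =
  #|[set j | t (arm j) == x]| + #|[set r | t (leg r) == x]|.
Proof.
rewrite -(card_imset _ arm_inj) -(card_imset _ leg_inj).
rewrite -cardsUI (_ : _ :&: _ = set0) ?cards0 ?addn0; last first.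
  apply/setP => b; rewrite !inE; apply/negP => /andP[/imsetP[j _ ->] /imsetP[r _]].
  exact: arm_leg.
apply: eq_card => b; rewrite !inE; case: (hook_box b) => [[j ->]|[r ->]].
  rewrite (mem_imset _ _ arm_inj) inE orbC; case: imsetP => // -[r _].
  by move/arm_leg.
rewrite (mem_imset _ _ leg_inj) inE; case: imsetP => // -[j _ /esym].
by move/arm_leg.
Qed.

Lemma kostka_neg (c : 'I_n -> int) i : (c i < 0)%R -> kostka theta c = 0.
Proof.
move=> ci; apply/eqP; rewrite cards_eq0; apply/eqP/setP => t; rewrite !inE.
apply/negP => /andP[_ /forallP/(_ i) /eqP e].
by rewrite -e in ci.
Qed.

(** The corner holds the smallest letter [mn] that occurs, the leg any [k] of the other occurring
    letters, and the arm the remaining letters in weakly increasing order. So [legs] is a bijection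
    onto these [k]-subsets. *)
Lemma kostka_hook (c : 'I_n -> int) : (forall i, 0 <= c i)%R ->
  (\sum_i c i = N%:Z)%R -> kostka theta c = 'C(#|[set i | c i != 0%R]|.-1, k).
Proof.
move=> c0 sc; pose m i : nat := `|c i|%N.
have mE i : (m i)%:Z%R = c i by rewrite /m gez0_abs.
have sm : \sum_i m i = N.
  apply/eqP; rewrite -eqz_nat -sc -natz natr_sum; apply/eqP.
  by apply: eq_bigr => i _; rewrite natz mE.
pose S := [set i | c i != 0%R].
have SE i : (i \in S) = (0 < m i) by rewrite inE -mE; lia.
have [x0 x0S] : exists x, x \in S.
  apply/card_gt0P; rewrite lt0n; apply: contraTneq kN => S0.
  rewrite -sm big1 ?ltn0 // => i _; apply/eqP; rewrite -leqn0 leqNgt -SE.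
  by rewrite (cards0_eq S0) inE.
have [mn mnS mnmin] : exists2 mn, mn \in S & forall x, x \in S -> mn <= x.
  by case: (arg_minnP (P := fun i => i \in S) (fun i : 'I_n => nat_of_ord i) x0S) => mn; exists mn.
pose legs (t : tableau) := [set t (leg r) | r in 'I_k].
rewrite (cardsD1 mn) mnS /= -cards_draws /kostka.
have contP (t : tableau) : has_content c t ->
    forall x, #|[set j | t (arm j) == x]| + #|[set r | t (leg r) == x]| = m x.
  move=> /forallP h x; have /eqP := h x; rewrite -mE card_hook_boxes.
  by case.
have corner_min (t : tableau) : semistandard t -> has_content c t -> t (arm corner) = mn.
  move=> /hook_semistandardP[h1 h2 h3] hc; apply: val_inj; apply/eqP; rewrite eqn_leq.
  have inS b : t b \in S.
    rewrite SE -(contP _ hc) -card_hook_boxes; apply/card_gt0P; exists b.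
    by rewrite inE.
  rewrite mnmin // andbT.
  have : 0 < m mn by rewrite -SE.
  rewrite -(contP _ hc) addn_gt0 => /orP[] /card_gt0P[j]; rewrite inE => /eqP <-.
    have [->//|jc] := eqVneq j corner; apply: h1.
    by rewrite lt0n; apply: contra jc => /eqP e; apply/eqP/val_inj.
  by apply: ltnW (h3 _).
have leg_card (t : tableau) : semistandard t ->
    forall x, #|[set r | t (leg r) == x]| = (x \in legs t).
  move=> /hook_semistandardP[h1 h2 h3] x.
  have inj : injective (fun r => t (leg r)).
    move=> r s e; apply: val_inj => /=.
    by case: (ltngtP r s) => // /h2; rewrite e ltnn.
  case: imsetP => [[r _ ->]|nx].
    by rewrite -[RHS](cards1 r); apply: eq_card => s; rewrite !inE (inj_eq inj).
  by apply/eqP; rewrite cards_eq0; apply/eqP/setP => r; rewrite !inE; apply/negP => /eqP e; apply: nx; exists r.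
rewrite -(card_in_imset (f := legs)); last first.
  move=> t t'; rewrite !inE => /andP[st ct] /andP[st' ct'] e.
  have [h1 h2 h3] := hook_semistandardP _ st; have [h1' h2' h3'] := hook_semistandardP _ st'.
  have eleg : (fun r => t (leg r)) =1 (fun r => t' (leg r)).
    apply: mono_unique => [r s /h2 /ltnW //|r s /h2' /ltnW //|x].
    by rewrite !leg_card // e.
  have earm : (fun j => t (arm j)) =1 (fun j => t' (arm j)).
    apply: mono_unique => // x; have := contP _ ct x; rewrite -(contP _ ct' x).
    by rewrite !leg_card // e => /addIn.
  by apply/ffunP => b; case: (hook_box b) => [[j ->]|[r ->]]; [apply: earm | apply: eleg].
apply: eq_card => A; apply/imsetP/idP => [[t + ->]|].
  rewrite inE => /andP[st ct]; have [h1 h2 h3] := hook_semistandardP _ st.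
  rewrite inE; apply/andP; split.
    apply/subsetP => x /imsetP[r _ ->]; rewrite !inE -/S; apply/andP; split.
      by rewrite -(corner_min t) // -val_eqE /= neq_ltn h3 orbT.
    have : t (leg r) \in S.
      rewrite SE -(contP _ ct) -card_hook_boxes; apply/card_gt0P; exists (leg r).
      by rewrite inE.
    by rewrite inE.
  apply/eqP; rewrite /legs card_imset ?card_ord // => r s e; apply: val_inj => /=.
  by case: (ltngtP r s) => // /h2; rewrite e ltnn.
rewrite inE => /andP[/subsetP AS /eqP Ak].
have Am x : x \in A -> 0 < m x by move=> /AS; rewrite !inE => /andP[_ xS]; rewrite -SE inE.
have [v vmono vcount] : exists2 v : 'I_k -> 'I_n, (forall i j : 'I_k, i < j -> v i <= v j)
    & forall x, #|[set i | v i == x]| = (x \in A).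
  apply: (@mono_exists n k (fun x => (x \in A) : nat)).
  by rewrite -Ak -sum1_card [RHS]big_mkcond; apply: eq_bigr => x _; case: (x \in A).
have [u umono ucount] : exists2 u : 'I_p -> 'I_n, (forall i j : 'I_p, i < j -> u i <= u j)
    & forall x, #|[set i | u i == x]| = m x - (x \in A).
  apply: mono_exists; rewrite sumnB => [|x _]; last by have := Am x; case: (x \in A) => // ->.
  rewrite sm /p; congr (_ - _).
  by rewrite -[RHS]Ak -sum1_card [RHS]big_mkcond; apply: eq_bigr => x _; case: (x \in A).
(* The value [mn] only makes the match total; every box below the first row has its index in the
   leg. *)
pose t : tableau := [ffun b => if (val (val b).1) is r.+1 then
   (if insub r is Some r' then v r' else mn) else u (val b).2].
have tarm j : t (arm j) = u j by rewrite ffunE /=; congr u; apply: val_inj.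
have tleg r : t (leg r) = v r by rewrite ffunE /= insubT //= => rk; congr v; apply: val_inj.
have vA r : v r \in A.
  have : 0 < #|[set i | v i == v r]| by apply/card_gt0P; exists r; rewrite inE.
  by rewrite vcount lt0b.
have vinj : injective v.
  move=> r s e; have : #|[set i | v i == v r]| <= 1 by rewrite vcount leq_b1.
  by move/card_le1_eqP; apply; rewrite inE ?e.
have u0 : u corner = mn.
  apply: val_inj; apply/eqP; rewrite eqn_leq; apply/andP; split.
    have : 0 < #|[set i | u i == mn]|.
      rewrite ucount subn_gt0; have -> : (mn \in A) = false.
        by apply/negP => /AS; rewrite !inE eqxx.
      by rewrite -SE.
    case/card_gt0P => j; rewrite inE => /eqP <-.
    have [->//|jc] := eqVneq j corner; apply: umono.
    by rewrite lt0n; apply: contra jc => /eqP e; apply/eqP/val_inj.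
  apply: mnmin; rewrite SE.
  have : 0 < #|[set i | u i == u corner]| by apply/card_gt0P; exists corner; rewrite inE.
  by rewrite ucount; lia.
exists t.
  rewrite inE; apply/andP; split.
    apply/hook_semistandardP; split=> [i j ij|r s rs|r]; rewrite ?tarm ?tleg.
    - exact: umono.
    - rewrite ltn_neqAle vmono // andbT; apply/eqP => /val_inj /vinj e.
      by rewrite e ltnn in rs.
    - have := AS _ (vA r); rewrite !inE -/S u0 => /andP[ne vS].
      rewrite ltn_neqAle mnmin ?inE // andbT; apply: contra ne => /eqP e.
      by apply/eqP/val_inj.
  apply/forallP => x; rewrite -mE card_hook_boxes; apply/eqP; congr Posz.
  rewrite (eq_card (B := [set i | u i == x])); last by move=> j; rewrite !inE tarm.
  rewrite ucount (eq_card (B := [set i | v i == x])); last by move=> j; rewrite !inE tleg.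
  by rewrite vcount subnK //; have := Am x; case: (x \in A) => // ->.
apply/setP => x; apply/idP/imsetP => [xA|[r _ ->]]; last by rewrite tleg.
have : 0 < #|[set i | v i == x]| by rewrite vcount xA.
by case/card_gt0P => r; rewrite inE => /eqP e; exists r; rewrite ?tleg.
Qed.

End HookKostka.

(** * Nonnegative combinations of sums over Young subgroups *)

Section YoungPositive.
Local Open Scope ring_scope.
Variable n : nat.
Notation word := {ffun 'I_n -> 'I_n}.

(* The linear functionals F |-> sum_c Z_c F(Young_c) / |Young_c| on class
   functions, the Young subgroups being the row stabilizers of words. *)
Definition young_positive (phi : ('S_n -> rat) -> rat) : Prop :=
  exists Z : word -> nat, forall F, class_function F ->
    phi F = \sum_c (Z c)%:R / #|[set w | row_stab c w]|%:R * row_sum c F.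

Lemma young_positive_ext phi psi : (forall F, class_function F -> phi F = psi F) ->
  young_positive phi -> young_positive psi.
Proof. by move=> e [Z hZ]; exists Z => F cF; rewrite -e ?hZ. Qed.

Lemma young_positive0 : young_positive (fun=> 0).
Proof. by exists (fun=> 0%N) => F _; rewrite big1 // => c _; rewrite !mul0r. Qed.

Lemma young_positiveD phi psi : young_positive phi -> young_positive psi ->
  young_positive (fun F => phi F + psi F).
Proof.
move=> [Z hZ] [Y hY]; exists (fun c => Z c + Y c)%N => F cF.
rewrite hZ // hY // -big_split; apply: eq_bigr => c _ /=.
by rewrite natrD !mulrDl.
Qed.

Lemma young_positiveM a phi : young_positive phi ->
  young_positive (fun F => a%:R * phi F).
Proof.
move=> [Z hZ]; exists (fun c => a * Z c)%N => F cF.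
by rewrite hZ // mulr_sumr; apply: eq_bigr => c _; rewrite natrM !mulrA.
Qed.

Lemma young_positive_sum (I : finType) (P : pred I) (phi : I -> ('S_n -> rat) -> rat) :
  (forall i, P i -> young_positive (phi i)) ->
  young_positive (fun F => \sum_(i | P i) phi i F).
Proof.
move=> h; have key (r : seq I) : young_positive (fun F => \sum_(i <- r | P i) phi i F).
  elim: r => [|i r IH].
    by apply: young_positive_ext young_positive0 => F _; rewrite big_nil.
  have [Pi|nPi] := boolP (P i).
    apply: young_positive_ext (young_positiveD (h i Pi) IH) => F _.
    by rewrite big_cons Pi.
  by apply: young_positive_ext IH => F _; rewrite big_cons (negPf nPi).
exact: key.
Qed.

(** If [H j <= j] for some [j], the first [j + 1] vertices have at most [j] admissible images and
    the sum is empty. Otherwise [H] is a Hessenberg function. *)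
Lemma hess_sum_young H : (forall i j, (i <= j < n)%N -> (H i <= H j <= n)%N) ->
  young_positive (hess_sum H).
Proof.
move=> mH; have mH' i j : (i <= j)%N -> (j < n)%N -> (H i <= H j)%N /\ (H j <= n)%N.
  by move=> ij jn; apply/andP; apply: mH; rewrite ij.
have [/forallP h|/forallPn[j]] := boolP [forall j : 'I_n, (j < H j)%N].
  apply: young_expansion; split=> [i iN|i j ij jn].
    by apply/andP; split; [exact: (h (Ordinal iN)) | case: (mH' i i (leqnn i) iN)].
  by case: (mH' i j ij jn).
rewrite -leqNgt => Hj; apply: young_positive_ext young_positive0 => F _.
rewrite /hess_sum big_pred0 // => w; apply/negbTE/negP => /forallP hw.
have : (#|[set i : 'I_n | (i < j.+1)%N]| <= #|[set i : 'I_n | (i < H j)%N]|)%N.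
  rewrite -(card_imset _ (@perm_inj _ w)); apply: subset_leq_card.
  apply/subsetP => k /imsetP[i + ->]; rewrite !inE ltnS => ij.
  by apply: leq_trans (hw i) _; case: (mH' i j ij (ltn_ord j)).
rewrite !card_ord_lt ?ltn_ord //; first by lia.
by apply: leq_trans Hj (ltnW (ltn_ord j)).
Qed.

End YoungPositive.

Lemma sum_Posz (n : nat) (f : nat -> nat) :
  (\sum_(i < n) Posz (f i))%R = Posz (\sum_(i < n) f i)%N.
Proof. by rewrite -natz natr_sum; apply: eq_bigr => i _; rewrite natz. Qed.

(** * From the Jacobi-Trudi pattern to Hessenberg functions *)

Section Decreasing.
Local Open Scope nat_scope.
Variables (n N k : nat) (A B : nat -> nat).
Hypotheses (A_decr : forall i j, i < j -> j < n -> A j < A i)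
           (B_decr : forall i j, i < j -> j < n -> B j < B i)
           (AB : forall i, i < n -> B i <= A i)
           (sumAB : \sum_(i < n) A i = \sum_(i < n) B i + N)
           (kN : k < N).

(** With A = mu + delta and B = nu + delta the Jacobi-Trudi entries are h_{A i - B j}; this counts
    the nonzero ones in column [j], which are its topmost ones. *)
Definition jt_bound (j : nat) : nat := #|[set i : 'I_n | B j <= A i]|.

Lemma jt_boundP (i : 'I_n) j : (i < jt_bound j) = (B j <= A i).
Proof.
rewrite /jt_bound -down_closed_mem ?inE // => x y xy; rewrite !inE => h.
apply: leq_trans h _; move: xy; rewrite leq_eqVlt => /orP[/eqP -> //|xy].
by apply: ltnW; apply: A_decr.
Qed.

Lemma jt_bound_le j : jt_bound j <= n.
Proof. by rewrite -[X in _ <= X](card_ord n) max_card. Qed.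

Lemma jt_bound_gt j : j < n -> j < jt_bound j.
Proof. by move=> jn; rewrite (jt_boundP (Ordinal jn)) /= AB. Qed.

Definition corners : {set 'I_n} := [set j : 'I_n | [exists i : 'I_n, A i == B j]].

(** As [A] is strictly decreasing, an entry h_0 = 1 is the last nonzero one of its column. *)
Lemma A_eq (i j : 'I_n) : (A i == B j) = (j \in corners) && (i.+1 == jt_bound j).
Proof.
have key (l : 'I_n) : A l = B j -> l.+1 = jt_bound j.
  move=> e; apply/eqP; rewrite eqn_leq jt_boundP e leqnn /= leqNgt.
  apply/negP => lt; have ln : l.+1 < n by apply: leq_trans lt (jt_bound_le _).
  by rewrite (jt_boundP (Ordinal ln)) -e leqNgt A_decr in lt.
rewrite inE; apply/idP/andP => [/eqP e|[/existsP[l /eqP e] /eqP il]].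
  by split; [apply/existsP; exists i; rewrite e | rewrite key].
by rewrite -e (_ : i = l) //; apply: val_inj => /=; have := key l e; lia.
Qed.

(** If every column had an entry h_0, then [A] and [B] would take the same values and have equal
    sums, against [0 < N]. *)
Lemma corners_lt : #|corners| < n.
Proof.
rewrite -[X in _ < X]card_ord -cardsT; apply: proper_card.
rewrite properE subsetT /=; apply/negP => /subsetP h.
have Hn (j : 'I_n) : (jt_bound j).-1 < n.
  by have := jt_bound_gt (ltn_ord j); have := jt_bound_le j; lia.
have e (j : 'I_n) : A (jt_bound j).-1 = B j.
  apply/eqP; rewrite (A_eq (Ordinal (Hn j)) j) h ?inE //=.
  by have := jt_bound_gt (ltn_ord j); lia.
have inj : injective (fun j => Ordinal (Hn j)).
  move=> i j [/(congr1 A)]; rewrite !e => eB; apply: val_inj => /=.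
  by case: (ltngtP i j) => // /B_decr; rewrite eB ltnn => /(_ (ltn_ord _)).
move: sumAB; rewrite (reindex_inj inj) /= (eq_bigr (fun i : 'I_n => B i)) //.
by lia.
Qed.

Definition bound_minus (S : {set 'I_n}) (j : nat) : nat :=
  jt_bound j - [exists x in S, nat_of_ord x == j].

Lemma bound_minusE S (j : 'I_n) : bound_minus S j = jt_bound j - (j \in S).
Proof.
congr (_ - nat_of_bool _); apply/existsP/idP => [[x /andP[xS /eqP /val_inj <-]] //|jS].
by exists j; rewrite jS /=.
Qed.

(** An entry h_0 in row [l] and column [j] is a corner: [A l = B j < B i] for [i < j], so row [l] is
    already outside the pattern in all earlier columns. *)
Lemma bound_minus_mono (S : {set 'I_n}) : S \subset corners ->
  forall i j, i <= j < n -> bound_minus S i <= bound_minus S j <= n.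
Proof.
move=> /subsetP Sc i j /andP[ij jn].
rewrite (leq_trans (leq_subr _ _) (jt_bound_le j)) andbT.
move: ij; rewrite leq_eqVlt => /orP[/eqP -> //|ij].
have iN := ltn_trans ij jn; apply: leq_trans (leq_subr _ _) _.
rewrite (bound_minusE S (Ordinal jn)) /=.
have le : jt_bound i <= jt_bound j.
  apply: subset_leq_card; apply/subsetP => x; rewrite !inE; apply: leq_trans.
  by apply: ltnW; apply: B_decr.
case: (boolP (_ \in S)) => [/Sc|_]; last by rewrite subn0.
rewrite inE => /existsP[l /[dup] Alj]; rewrite A_eq /= => /andP[_ /eqP <-].
rewrite subn1 /= leqNgt jt_boundP -ltnNge (eqP Alj).
exact: B_decr.
Qed.

Definition unused (w : 'S_n) : {set 'I_n} :=
  [set j in corners | (w j).+1 != jt_bound j].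

Lemma hess_perm_minus (S : {set 'I_n}) w : S \subset corners ->
  hess_perm (bound_minus S) w = hess_perm jt_bound w && (S \subset unused w).
Proof.
move=> /subsetP Sc; apply/forallP/andP => [h|[/forallP h /subsetP Su] j].
  split; first by apply/forallP => j; apply: leq_trans (h j) (leq_subr _ _).
  apply/subsetP => j jS; rewrite inE (Sc _ jS) /=.
  by have := h j; rewrite bound_minusE jS; lia.
have := h j; rewrite bound_minusE; case: (boolP (j \in S)) => [/Su|_]; last by lia.
by rewrite inE => /andP[_]; lia.
Qed.

Lemma hook_kostka_expansion :
  young_positive (fun F : 'S_n -> rat => \sum_(w : 'S_n)
    (kostka ((N - k)%N :: nseq k 1%N) (fun i => (A i)%:Z - (B ((w^-1)%g i))%:Z))%:R * F w)%R.
Proof.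
pose r := #|corners|; pose m := n.-1 - r.
pose K (w : 'S_n) := kostka ((N - k) :: nseq k 1) (fun i => (A i)%:Z - (B ((w^-1)%g i))%:Z)%R.
have n0 : 0 < n by apply: leq_ltn_trans corners_lt.
have hpE (w : 'S_n) : hess_perm jt_bound w = [forall i, B ((w^-1)%g i) <= A i].
  apply/forallP/forallP => h i.
    by have := h ((w^-1)%g i); rewrite permKV jt_boundP.
  by rewrite jt_boundP; have := h (w i); rewrite permK.
have Kval (w : 'S_n) : K w = if hess_perm jt_bound w
    then \sum_(S : {set 'I_n} | (S \subset unused w) && (#|S| <= k)) 'C(m, k - #|S|) else 0.
  rewrite hpE; case: ifP => [/forallP h|/negbT]; last first.
    rewrite negb_forall => /existsP[i hi]; apply: (@kostka_neg _ _ _ _ i).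
    by rewrite subr_lt0 ltz_nat ltnNge.
  rewrite /K (kostka_hook kN); last first.
  - rewrite sumrB [X in (_ - X)%R](_ : _ = \sum_(j : 'I_n) (B (nat_of_ord j))%:Z)%R; last first.
      by rewrite [RHS](reindex_inj (@perm_inj _ (w^-1)%g)).
    by rewrite !sum_Posz sumAB PoszD addrAC subrr add0r.
  - by move=> i; rewrite subr_ge0 lez_nat.
  (* Transported to columns by [w^-1], the zero entries of the content are the entries h_0 = 1 that
     [w] uses. *)
  have -> : #|[set i : 'I_n | (A i)%:Z - (B ((w^-1)%g i))%:Z != 0]%R|.-1 = m + #|unused w|.
    rewrite -[in LHS](card_imset _ (@perm_inj _ (w^-1)%g)).
    have -> : [set ((w^-1)%g i) | i : 'I_n in [set i : 'I_n | (A i)%:Z - (B ((w^-1)%g i))%:Z != 0]%R]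
        = ~: [set j in corners | (w j).+1 == jt_bound j].
      apply/setP => j; rewrite !inE; apply/imsetP/idP => [[i + ->]|hj].
        rewrite inE subr_eq0 eqz_nat A_eq permKV.
        by rewrite inE.
      exists (w j); last by rewrite permK.
      by rewrite inE subr_eq0 eqz_nat A_eq permK inE.
    have := cardsC [set j in corners | (w j).+1 == jt_bound j]; rewrite card_ord.
    have : #|unused w| + #|[set j in corners | (w j).+1 == jt_bound j]| = r.
      rewrite /r -(cardsID [set j : 'I_n | (w j).+1 == jt_bound j] corners) addnC.
      by congr (_ + _); apply: eq_card => j; rewrite !inE andbC.
    by have := corners_lt; rewrite -/r /m; lia.
  rewrite addnC -binomial.Vandermonde.
  rewrite [RHS](partition_big (fun S : {set 'I_n} => inord #|S| : 'I_k.+1) xpredT) //=.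
  apply: eq_bigr => i _; rewrite -cards_draws -sum1_card big_distrl /=.
  have ik : i <= k by rewrite -ltnS.
  apply: eq_big => [S|S].
    rewrite inE -andbA; congr (_ && _); rewrite -val_eqE /=.
    case: (leqP #|S| k) => Sk /=; first by rewrite inordK.
    by apply/eqP => e; rewrite e leqNgt ltnS ik in Sk.
  by rewrite inE mul1n => /andP[_ /eqP ->].
apply: (@young_positive_ext n (fun F : 'S_n -> rat =>
    \sum_(S : {set 'I_n} | (S \subset corners) && (#|S| <= k)%N)
      'C(m, (k - #|S|)%N)%:R * hess_sum (bound_minus S) F)%R).
  move=> F cF; rewrite /hess_sum.
  under eq_bigr => S _ do rewrite mulr_sumr.
  rewrite (exchange_big_dep xpredT) //=; apply: eq_bigr => w _.
  rewrite -mulr_suml -/(K w) Kval; congr (_ * _)%R.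
  have [hw|hw] := boolP (hess_perm jt_bound w); last first.
    rewrite big_pred0 // => S; apply/negP => /andP[/andP[Sc _]].
    by rewrite hess_perm_minus // (negPf hw).
  rewrite natr_sum; apply: eq_bigl => S.
  have [Sc|nSc] := boolP (S \subset corners); last first.
    rewrite /=; apply/esym/negP => /andP[/subset_trans Su _]; case/negP: nSc; apply: Su.
    by apply/subsetP => j; rewrite inE => /andP[].
  by rewrite hess_perm_minus // hw andbC.
apply: young_positive_sum => S /andP[Sc _]; apply: young_positiveM.
by apply: hess_sum_young; apply: bound_minus_mono.
Qed.

End Decreasing.

(** * Permutation characters on cosets of Young subgroups *)

Lemma perm_repr_char (gT : finGroupType) (T : finType) (to : {action gT &-> T}) (g : gT) :
  cfRepr (perm_repr to) g = (#|[set x | to x g == x]|%:R)%R.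
Proof.
rewrite cfunE in_setT mulr1n /mxtrace -sum1dep_card natr_sum [RHS]big_mkcond /=.
transitivity (\sum_(x in T) (if to x g == x then 1 else 0) : algC)%R; last exact: eq_bigl.
by rewrite [RHS]big_enum_val; apply: eq_bigr => i _; rewrite mxE; case: eqP.
Qed.

Section YoungCosets.
Local Open Scope group_scope.
Variable n : nat.
Notation word := {ffun 'I_n -> 'I_n}.

Lemma row_group_young (c : word) : is_young_subgroup (row_group c).
Proof.
exists (preim_partition (height c) [set: 'I_n]); first exact: preim_partitionP.
apply/setP => s; rewrite !inE; apply/forallP/forallP => [h B|h i].
  apply/implyP => /imsetP[x _ ->]; rewrite eqEcard card_imset ?leqnn ?andbT; last exact: perm_inj.
  apply/subsetP => y /imsetP[z + ->]; rewrite !inE /= => /eqP ->.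
  by rewrite eq_sym.
have /implyP := h [set y in [set: 'I_n] | [rel x y | height c x == height c y] i y].
have iB : i \in [set y in [set: 'I_n] | [rel x y | height c x == height c y] i y] by rewrite !inE /=.
move=> hB; have /eqP e := hB (imset_f _ (in_setT i)).
by have := imset_f s iB; rewrite e !inE /= eq_sym.
Qed.

(** Both sides count the [x] with [w ^ x^-1] in [Y]: by their cosets [Y :* x], which are the ones
    fixed by [w], and by the value of [w ^ x^-1], each taken on a coset of the centralizer. *)
Lemma card_fixed_rcosets (gT : finGroupType) (Y : {group gT}) (w : gT) :
  (#|[set X in rcosets Y [set: gT] | X :* w == X]| * #|Y|
   = #|w ^: [set: gT] :&: Y| * #|'C[w]|)%N.
Proof.
transitivity #|[set x : gT | w ^ x^-1 \in Y]|.
  rewrite -sum1_card big_distrl /=.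
  rewrite -[RHS]sum1_card (partition_big (fun x => Y :* x) (mem [set X in rcosets Y [set: gT] | X :* w == X])) /=.
    apply: eq_bigr => X; rewrite inE => /andP[/rcosetsP[a _ ->] /eqP fa].
    rewrite mul1n -(card_rcoset Y a) -sum1_card; apply: eq_bigl => x; rewrite inE.
    apply/idP/andP => [xa|[_ /eqP <-]]; last exact: rcoset_refl.
    have e : Y :* x = Y :* a by apply/rcoset_eqP.
    rewrite e eqxx; split=> //; move: fa; rewrite -e.
    rewrite -rcosetM => /rcoset_eqP; rewrite mem_rcoset => h.
    by rewrite conjgE invgK mulgA.
  move=> x; rewrite !inE => xw; rewrite mem_rcosets mulSGid ?subsetT // inE /=.
  rewrite -rcosetM; apply/eqP/rcoset_eqP.
  by rewrite mem_rcoset -mulgA; move: xw; rewrite conjgE invgK.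
rewrite -sum1_card (partition_big (fun x => w ^ x^-1) (mem (w ^: [set: gT] :&: Y))) /=.
  rewrite -[X in (X * _)%N]sum1_card big_distrl /=; apply: eq_bigr => v.
  rewrite inE => /andP[/imsetP[g _ ->] vY].
  rewrite mul1n -(card_lcoset _ g^-1) -sum1_card; apply: eq_bigl => x.
  rewrite inE mem_lcoset invgK.
  transitivity (w ^ x^-1 == w ^ g).
    by case: eqP => [->|]; rewrite ?vY ?andbF.
  rewrite -(inj_eq (conjg_inj x)) conjgKV -conjgM eq_sym.
  by rewrite -(inj_eq (mulgI (g * x))) -conjgC cent1E eq_sym.
move=> x; rewrite inE => xw; rewrite inE xw andbT; apply: memJ_class.
by rewrite inE.
Qed.

Section Action.
Variable Z : word -> nat.

(** Indexes [Z c] copies of the coset space of each row stabilizer; it is kept beside the coset so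
    that the copies stay disjoint. *)
Definition coset_index : finType := {c : word & 'I_(Z c)}.

Definition young_coset (p : coset_index * {set 'S_n}) : bool :=
  p.2 \in rcosets (row_group (tag p.1)) [set: 'S_n].

Definition young_set : finType := {p : coset_index * {set 'S_n} | young_coset p}.

Lemma young_coset_act (x : young_set) (g : 'S_n) :
  young_coset ((val x).1, (val x).2 :* g).
Proof.
case: x => -[i X] /= /rcosetsP[a _ /= ->]; rewrite /young_coset /= -rcosetM.
by apply/rcosetsP; exists (a * g); rewrite ?inE.
Qed.

Definition young_act (x : young_set) (g : 'S_n) : young_set :=
  exist young_coset _ (young_coset_act x g).

Lemma young_act1 : young_act^~ 1 =1 id.
Proof. by move=> x; apply: val_inj; rewrite /= rcoset1; case: (val x). Qed.

Lemma young_actM x : act_morph young_act x.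
Proof. by move=> g h; apply: val_inj; rewrite /= rcosetM. Qed.

Definition young_action := TotalAction young_act1 young_actM.

Lemma young_action_fix (w : 'S_n) : #|[set x | young_action x w == x]| =
  (\sum_c Z c * #|[set X in rcosets (row_group c) [set: 'S_n] | X :* w == X]|)%N.
Proof.
rewrite -(card_imset _ val_inj).
have -> : [set val x | x in [set x | young_action x w == x]] =
    [set p : coset_index * {set 'S_n} |
      p.2 \in [set X in rcosets (row_group (tag p.1)) [set: 'S_n] | X :* w == X]].
  apply/setP => p; rewrite !inE; apply/imsetP/andP => [[x + ->]|[hp /eqP e]].
    rewrite inE => /eqP/(congr1 (fun y => (val y).2)) /= e.
    by split; [exact: (valP x) | apply/eqP].
  exists (exist young_coset p hp) => //; rewrite inE; apply/eqP/val_inj => /=.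
  by rewrite e; case: (p).
rewrite -sum1dep_card.
rewrite -(pair_big_dep xpredT (fun (i : coset_index) (X : {set 'S_n}) =>
  X \in [set X in rcosets (row_group (tag i)) [set: 'S_n] | X :* w == X]) (fun _ _ => 1%N)) /=.
rewrite (eq_bigr (fun i : coset_index =>
  #|[set X in rcosets (row_group (tag i)) [set: 'S_n] | X :* w == X]|)); last first.
  by move=> i _; rewrite sum1_card.
rewrite -(sig_big_dep xpredT (fun _ => xpredT) (fun c (_ : 'I_(Z c)) =>
  #|[set X in rcosets (row_group c) [set: 'S_n] | X :* w == X]|)) /=.
by apply: eq_bigr => c _; rewrite sum_nat_const card_ord.
Qed.

Lemma young_action_orbit (x : young_set) : exists2 H : {group 'S_n},
  is_young_subgroup H & orbit_isom_cosets young_action x H.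
Proof.
exists (row_group (tag (val x).1)); first exact: row_group_young.
exists (fun y => (val y).2); split=> //.
- move=> y z /orbitP[g _ <-] /orbitP[h _ <-] /= e.
  by apply: val_inj; rewrite /= e.
- have /rcosetsP[b _ xb] := valP x.
  apply/setP => X; apply/imsetP/rcosetsP => [[y /orbitP[g _ <-] ->]|[a _ ->]].
    by exists (b * g); rewrite ?inE //= xb rcosetM.
  exists (young_action x (b^-1 * a)); first by apply: mem_orbit; rewrite inE.
  by rewrite /= xb -rcosetM mulgA mulgV mul1g.
Qed.

End Action.

Lemma card_class_cent1 (w : 'S_n) : (#|w ^: [set: 'S_n]| * #|'C[w]| = n`!)%N.
Proof.
rewrite -index_cent1 setTI mulnC Lagrange ?subsetT // cardsT card_Sn //.
Qed.

(** The functional is evaluated at the indicator function of the class of [w]. Since [n!] divided by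
    the class size is the order of the centralizer, each summand counts fixed cosets by
    [card_fixed_rcosets]. *)
Lemma young_positive_character (K : 'S_n -> nat) (chi : 'S_n -> int) :
    young_positive (fun F => \sum_w (K w)%:R * F w)%R ->
    (forall w, let C := w ^: [set: 'S_n] in
       chi w = ((n`! %/ #|C|)%N%:Z * \sum_(w' in C) (K w')%:Z)%R) ->
  is_young_permutation_character chi.
Proof.
move=> [Z hZ] chiE; exists (young_set Z), (young_action Z); split=> [w|x]; last first.
  exact: young_action_orbit.
rewrite perm_repr_char young_action_fix.
set T := (\sum_c _)%N; suff -> : chi w = Posz T by rewrite -pmulrn.
rewrite chiE; set C := w ^: _.
have cent : (n`! %/ #|C|)%N = #|'C[w]|.
  by rewrite -(card_class_cent1 w) mulKn // card_gt0 -/C; apply/set0Pn; exists w; apply: class_refl.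
have cC : class_function (fun v : 'S_n => (v \in C)%:R : rat)%R.
  move=> v g; congr (nat_of_bool _)%:R%R.
  by apply/imsetP/imsetP => -[h _ e]; [exists (h * g^-1) | exists (h * g)];
    rewrite ?inE // conjgM -?e // conjgK.
have sumC : (\sum_(w' in C) K w' = \sum_w' K w' * (w' \in C))%N.
  by rewrite big_mkcond; apply: eq_bigr => v _; case: (v \in C); rewrite ?muln1 ?muln0.
have -> : (\sum_(w' in C) (K w')%:Z)%R = Posz (\sum_w' K w' * (w' \in C))%N.
  by rewrite -sumC -natz natr_sum; apply: eq_bigr => v _; rewrite natz.
rewrite cent -PoszM; congr Posz; apply/eqP; rewrite -(eqr_nat rat) natrM natr_sum.
rewrite (eq_bigr (fun v : 'S_n => (K v)%:R * (v \in C)%:R)%R) => [|v _]; last by rewrite natrM.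
rewrite (hZ _ cC) /T natr_sum mulr_sumr; apply/eqP; apply: eq_bigr => c _.
have -> : row_sum c (fun v => (v \in C)%:R)%R = (#|C :&: row_group c|%:R : rat)%R.
  rewrite /row_sum -sum1_card natr_sum big_mkcond [RHS]big_mkcond /=.
  apply: eq_bigr => v _; rewrite !inE andbC -/C.
  by case: (row_stab c v); case: (v \in C).
have Y0 : (#|[set v | row_stab c v]|%:R != 0 :> rat)%R.
  by rewrite pnatr_eq0 -lt0n (cardG_gt0 (row_group c)).
have := card_fixed_rcosets (row_group c) w; rewrite -/C => /(congr1 (fun z => z%:R : rat)%R).
rewrite !natrM /=; set fx := #|[set X in _ | _]|; move=> e.
have {}e : (fx%:R = #|C :&: row_group c|%:R * #|'C[w]|%:R / #|[set v | row_stab c v]|%:R :> rat)%R.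
  by rewrite -e mulfK.
by rewrite e; ring.
Qed.

End YoungCosets.

(** * Application to skew shapes *)

Lemma part_noninc la i j : is_partition la -> 0 < i -> i <= j -> part la j <= part la i.
Proof.
move=> /andP[sla _] i0 ij; rewrite /part.
have [jl|lj] := ltnP j.-1 (size la); last by rewrite nth_default.
have geq_trans : transitive geq by move=> y x z h1 h2; apply: leq_trans h2 h1.
by apply: (sorted_leq_nth geq_trans (leqnn : reflexive geq)) => //; rewrite ?inE; lia.
Qed.

(** The differences vanish beyond [skew_length] and beyond [size mu], so both sums extend to a
    common range. *)
Lemma sum_part_diff n mu nu : is_skew_shape mu nu -> skew_length mu nu <= n ->
  \sum_(i < n) (part mu i.+1 - part nu i.+1) = skew_size mu nu.
Proof.
move=> [_ _ le] hn.
have z i : size mu < i -> part mu i - part nu i = 0.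
  by move=> hi; rewrite /part [nth 0 mu _]nth_default //; lia.
have z' i : 0 < i -> n < i -> part mu i - part nu i = 0.
  move=> i0 ni; have [|hi] := ltnP (size mu) i; first exact: z.
  apply/eqP; rewrite subn_eq0 leqNgt; apply/negP => lt.
  have : i <= skew_length mu nu.
    have ir : i \in index_iota 1 (size mu).+1 by rewrite mem_index_iota i0.
    exact: (@leq_bigmax_seq _ _ (fun i => part nu i < part mu i) id i ir lt).
  by rewrite leqNgt (leq_ltn_trans hn ni).
pose f i := part mu i.+1 - part nu i.+1.
have ext m m' : m <= m' -> (forall i, m <= i -> f i = 0) -> \sum_(i < m) f i = \sum_(i < m') f i.
  move=> mm hz; rewrite (big_ord_widen m' f mm) big_mkcond; apply: eq_bigr => i _.
  by case: ltnP => // /hz.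
rewrite /skew_size big_add1 /= big_mkord -/(f _).
transitivity (\sum_(i < n + size mu) f i).
  by apply: ext => [|i ni]; [rewrite leq_addr | apply: z'].
by symmetry; apply: ext => [|i ni]; [rewrite leq_addl | apply: z].
Qed.

Theorem corollaryB (n N : nat) (theta mu nu : seq nat)
    (Htheta : is_hook N theta)
    (Hskew : is_skew_shape mu nu)
    (Hsize : skew_size mu nu = N)
    (Hlen : skew_length mu nu <= n)
    (Hcase : pre_abelian mu nu \/ ~ contains_3x3_box mu nu) :
  is_young_permutation_character (@immanant_char n theta mu nu).
Proof.
have [k kN ->] := Htheta; have [pmu pnu le] := Hskew.
(* The sequence [shifted] with values in the naturals; it is strictly decreasing on the indices
   below [n]. *)
pose sh la i := part la i.+1 + (n - i.+1).
have decr la : is_partition la -> forall i j, i < j -> j < n -> sh la j < sh la i.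
  move=> pla i j ij jn; have := part_noninc pla (ltn0Sn i) (ltnW ij : i.+1 <= j.+1).
  by rewrite /sh; lia.
have sumE : \sum_(i < n) sh mu i = \sum_(i < n) sh nu i + N.
  rewrite -Hsize -(sum_part_diff Hskew Hlen) -big_split; apply: eq_bigr => i _ /=.
  by have := le i.+1 isT; rewrite /sh; lia.
apply: young_positive_character
  (hook_kostka_expansion (decr mu pmu) (decr nu pnu) _ sumE kN) _ => [i _|w] //.
by rewrite leq_add2r le.
Qed.
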